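(* Let $A$ be a separable $C^*$-algebra. If $A$ is projective, then $A$ is residually finite dimensional (RFD). If $A$ is MF and semiprojective, then $A$ is RFD.
   Context: A $C^*$-algebra $A$ is projective if for every $C^*$-algebra $B$, closed two-sided ideal $I \subset B$ and $*$-homomorphism $\phi : A \to B/I$ there exists a $*$-homomorphism $\psi : A \to B$ lifting $\phi$ (i.e. $\psi$ composed with the quotient map $B \to B/I$ equals $\phi$). $A$ is semiprojective if for every $C^*$-algebra $B$, every closed two-sided ideal $I \subset B$ with $I = \overline{\bigcup_n I_n}$ for (closed two-sided) ideals $I_1 \subset I_2 \subset \cdots$ of $B$, and every $*$-homomorphism $\phi : A \to B/I$, there exist an $n$ and a $*$-homomorphism $\psi : A \to B/I_n$ lifting $\phi$ with respect to the canonical quotient map $B/I_n \to B/I$. A $C^*$-algebra $R$ is RFD if for each nonzero $x \in R$ there exists a $*$-homomorphism $\pi : R \to B$ with $\dim(B) < \infty$ and $\pi(x) \neq 0$. A (separable) $C^*$-algebra $A$ is MF if it is isomorphic to a $C^*$-subalgebra of $\prod_i M_{n(i)}(\mathbb{C}) / \bigoplus_i M_{n(i)}(\mathbb{C})$ for some sequence of positive integers $(n(i))_{i\in\mathbb{N}}$, where $\prod$ denotes bounded sequences and $\bigoplus$ denotes sequences whose norms tend to $0$. *)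

(* Defs.v *)
From HB Require Import structures.
From mathcomp Require Import all_boot all_order all_algebra.
From mathcomp Require Import all_classical all_reals.
From mathcomp Require Import topology normedtype sequences.
From mathcomp Require Import complex ring lra.
Set Implicit Arguments.
Unset Strict Implicit.
Unset Printing Implicit Defensive.
Import Order.TTheory GRing.Theory Num.Theory Normc.
Import numFieldNormedType.Exports.
Local Open Scope classical_set_scope.
Local Open Scope ring_scope.
Local Open Scope complex_scope.

Reserved Notation "x ** y" (at level 40, left associativity).

(* Complex *-algebras; no unit is assumed. The scalar field is [R[i]], and
   [conjc] is complex conjugation. *)
HB.mixin Record isStarAlg (R : rcfType) (A : Type) & GRing.Lmodule R[i] A := {
  starmul : A -> A -> A;
  star : A -> A;
  starmulA : associative starmul;
  starmulDl : left_distributive starmul +%R;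
  starmulDr : right_distributive starmul +%R;
  starmulZl : forall (k : R[i]) (x y : A),
    starmul (k *: x) y = k *: starmul x y;
  starmulZr : forall (k : R[i]) (x y : A),
    starmul x (k *: y) = k *: starmul x y;
  starK : involutive star;
  starD : {morph star : x y / x + y};
  starZ : forall (k : R[i]) (x : A), star (k *: x) = (k^*)%C *: star x;
  starM : forall x y : A, star (starmul x y) = starmul (star y) (star x)
}.

#[short(type="starAlgType")]
HB.structure Definition StarAlg (R : rcfType) :=
  {A of GRing.Lmodule R[i] A & isStarAlg R A}.

Notation "x ** y" := (starmul x y) : ring_scope.

HB.mixin Record isCStarAlg (R : realType) (A : Type)
    & StarAlg R A & CompleteNormedModule R[i] A := {
  cstar_normM : forall x y : A, `|x ** y| <= `|x| * `|y|;
  cstar_norm : forall x : A, `|star x ** x| = `|x| ^+ 2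
}.

#[short(type="cstarType")]
HB.structure Definition CStarAlg (R : realType) :=
  {A of StarAlg R A & CompleteNormedModule R[i] A & isCStarAlg R A}.

Record is_starhom (R : rcfType) (A B : starAlgType R) (f : A -> B) : Prop :=
  IsStarHom {
  starhom_linear : forall (k : R[i]) (x y : A), f (k *: x + y) = k *: f x + f y;
  starhom_mul : {morph f : x y / x ** y};
  starhom_star : {morph f : x / star x}
}.

Record cstar_ideal (R : realType) (B : cstarType R) := CStarIdeal {
  ideal_set :> set B;
  ideal0 : ideal_set 0;
  idealD : forall x y, ideal_set x -> ideal_set y -> ideal_set (x + y);
  idealZ : forall (k : R[i]) x, ideal_set x -> ideal_set (k *: x);
  idealMl : forall b x, ideal_set x -> ideal_set (b ** x);
  idealMr : forall b x, ideal_set x -> ideal_set (x ** b);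
  ideal_closed : closed ideal_set
}.
Section RealNorm.
Variables (R : rcfType) (V : normedModType R[i]).
Implicit Types x y : V.

(* Norms of a [normedModType R[i]] are nonnegative elements of [R[i]]; [nrm] is
   the same norm with values in [R]. *)
Definition nrm x : R := complex.Re `|x|.

Lemma nrmE x : `|x| = (nrm x)%:C.
Proof. by rewrite /nrm RRe_real ?ger0_real. Qed.

Lemma nrm_ge0 x : 0 <= nrm x.
Proof. by rewrite -lecR -nrmE; exact: normr_ge0. Qed.

Lemma nrmD x y : nrm (x + y) <= nrm x + nrm y.
Proof. by rewrite -lecR -nrmE rmorphD/= -!nrmE ler_normD. Qed.

Lemma nrmN x : nrm (- x) = nrm x.
Proof. by rewrite /nrm normrN. Qed.

Lemma nrmB x y : nrm (x - y) = nrm (y - x).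
Proof. by rewrite /nrm distrC. Qed.

Lemma nrm0 : nrm (0 : V) = 0.
Proof. by rewrite /nrm normr0. Qed.

Lemma nrm0_eq0 x : nrm x = 0 -> x = 0.
Proof. by move=> x0; apply/normr0_eq0; rewrite nrmE x0. Qed.

Lemma nrmZ (k : R[i]) x : nrm (k *: x) = normc k * nrm x.
Proof.
by apply: complexI; rewrite rmorphM/= -!nrmE normrZ.
Qed.

Lemma normc_real (k : R) : normc k%:C = `|k|.
Proof. by rewrite /= expr0n addr0 sqrtr_sqr. Qed.

Lemma normc_ge0 (k : R[i]) : 0 <= normc k.
Proof. by case: k => a b /=; rewrite sqrtr_ge0. Qed.

Lemma nrmZr (k : R) x : nrm (k%:C *: x) = `|k| * nrm x.
Proof. by rewrite nrmZ normc_real. Qed.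

End RealNorm.

Section CStarNorm.
Variables (R : realType) (B : cstarType R).
Implicit Types x y a b u v z : B.

Lemma starB x y : star (x - y) = star x - star y.
Proof. by rewrite -scaleN1r starD starZ rmorphN rmorph1 scaleN1r. Qed.

Lemma star0 : star (0 : B) = 0.
Proof. by have := starB 0 0; rewrite !subrr. Qed.

Lemma starmulBl x y z : (x - y) ** z = x ** z - y ** z.
Proof. by rewrite -scaleN1r starmulDl starmulZl scaleN1r. Qed.

Lemma starmulBr x y z : z ** (x - y) = z ** x - z ** y.
Proof. by rewrite -scaleN1r starmulDr starmulZr scaleN1r. Qed.

Lemma starZr (k : R) x : star (k%:C *: x) = k%:C *: star x.
Proof. by rewrite starZ conjc_real. Qed.

Lemma nrmM x y : nrm (x ** y) <= nrm x * nrm y.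
Proof. by rewrite -lecR -nrmE rmorphM/= -!nrmE cstar_normM. Qed.

Lemma nrm_cstar x : nrm (star x ** x) = nrm x ^+ 2.
Proof. by apply: complexI; rewrite rmorphXn/= -!nrmE cstar_norm. Qed.

Lemma nrm_star x : nrm (star x) = nrm x.
Proof.
have le y : nrm y <= nrm (star y).
  have [->|y0] := eqVneq (nrm y) 0; first exact: nrm_ge0.
  have yp : 0 < nrm y by rewrite lt_def y0 nrm_ge0.
  by rewrite -(ler_pM2r yp) -expr2 -nrm_cstar nrmM.
by apply/eqP; rewrite eq_le le andbT -{2}(starK x) le.
Qed.

End CStarNorm.

Section IdealStar.
Variables (R : realType) (B : cstarType R).
Implicit Types x y a b u v z : B.

(* For selfadjoint [a], put [p = a - kap a^3] and [q = 5/9 - 9/10 a^2] with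
   [kap = 81/200]. Then [p^2 + q^2 = 25/81 + kap^2 a^6], hence for [|a| <= 1]
   left multiplication by [p +- i q], and so by [p], has norm at most
   [69/100]. *)
Let kap : R := 81%:R / 200%:R.

Let aux_cancel (V : zmodType) (h e f0 f6 : V) :
  (h + h) - e - (e - f6) + (f0 - h - (h - (e + e))) = f0 + f6.
Proof.
have -> : (h + h) - e - (e - f6) = h + h - (e + e) + f6.
  by rewrite opprB opprD !addrA addrAC.
have -> : f0 - h - (h - (e + e)) = f0 - (h + h - (e + e)).
  by rewrite -(addrA f0) -opprD addrA.
by rewrite addrC addrA subrK.
Qed.

Lemma selfadj_contract a b : star a = a -> nrm a <= 1 ->
  nrm (a ** b - kap%:C *: (a ** (a ** (a ** b)))) <= 69%:R / 100%:R * nrm b.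
Proof.
move=> sa a1.
pose L x := a ** x.
have Lle x : nrm (L x) <= nrm x.
  by apply: le_trans (nrmM _ _) _; rewrite ler_piMl ?nrm_ge0.
pose P := L b - kap%:C *: L (L (L b)).
pose be : R := 5%:R / 9%:R.
pose ga : R := 9%:R / 10%:R.
pose Q := be%:C *: b - ga%:C *: L (L b).
have shift x y : star (L x) ** y = star x ** L y.
  by rewrite /L starM sa starmulA.
have PQ : star P ** Q = star Q ** P.
  rewrite /P /Q !starB !starZr !(starmulBl, starmulBr, starmulZl, starmulZr).
  rewrite !shift !scalerA [be%:C * kap%:C]mulrC [ga%:C * kap%:C]mulrC !opprB.
  by rewrite [LHS]addrACA [RHS]addrACA; congr (_ + _); rewrite addrC.
pose g0 := star b ** b.
pose g6 := star b ** L (L (L (L (L (L b))))).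
have E1 : be%:C * ga%:C = 2^-1.
  rewrite -rmorphM -(rmorph_nat (real_complex R)) -fmorphV.
  by congr (_%:C); rewrite /be /ga; field.
have E2 : ga%:C * ga%:C = kap%:C *+ 2.
  rewrite -rmorphM -rmorphMn; congr (_%:C).
  by rewrite -mulr_natr /ga /kap; field.
have PPQQ : star P ** P + star Q ** Q =
    (be%:C * be%:C) *: g0 + (kap%:C * kap%:C) *: g6.
  rewrite /P /Q !starB !starZr !(starmulBl, starmulBr, starmulZl, starmulZr).
  rewrite !shift -/g0 -/g6 !scalerA.
  set g2 := star b ** L (L b); set g4 := star b ** L (L (L (L b))).
  rewrite [ga%:C * be%:C]mulrC E2 mulr2n scalerDl E1.
  have {1}-> : g2 = 2^-1 *: g2 + 2^-1 *: g2.
    by rewrite -scalerDl -[2^-1]mul1r -splitr scale1r.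
  exact: aux_cancel.
have CC (s : R[i]) : s + (s^*)%C = 0 -> s * (s^*)%C = 1 ->
    nrm (P + s *: Q) <= 69%:R / 100%:R * nrm b.
  move=> s0 s1; set u := P + s *: Q.
  have uu : star u ** u = (be%:C * be%:C) *: g0 + (kap%:C * kap%:C) *: g6.
    rewrite -PPQQ /u; clear PPQQ u; move: P Q PQ => P Q PQ.
    rewrite starD starZ !(starmulDl, starmulDr, starmulZl, starmulZr).
    rewrite scalerDr -PQ scalerA [(s^*)%C * s]mulrC s1 scale1r.
    by rewrite addrA -[X in X + _]addrA -scalerDl s0 scale0r addr0.
  rewrite -(@ler_pXn2r _ 2) ?nnegrE ?nrm_ge0 ?mulr_ge0 ?nrm_ge0//; last by lra.
  rewrite -nrm_cstar uu.
  apply: le_trans (nrmD _ _) _.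
  have g0le : nrm g0 <= nrm b ^+ 2 by rewrite /g0 nrm_cstar.
  have g6le : nrm g6 <= nrm b ^+ 2.
    rewrite /g6; apply: le_trans (nrmM _ _) _.
    rewrite nrm_star expr2 ler_wpM2l ?nrm_ge0//.
    by do 5! apply: le_trans (Lle _) _.
  rewrite -!rmorphM !nrmZr exprMn.
  have be0 : 0 <= be * be by rewrite /be; lra.
  have kap0 : 0 <= kap * kap by rewrite /kap; lra.
  rewrite (ger0_norm be0) (ger0_norm kap0).
  have := sqr_ge0 (nrm b); rewrite /be /kap.
  move: (nrm g0) (nrm g6) (nrm b ^+ 2) g0le g6le => r0 r6 t *.
  lra.
have C1 : nrm (P + 'i%C *: Q) <= 69%:R / 100%:R * nrm b.
  by apply: CC; simpc.
have C2 : nrm (P - 'i%C *: Q) <= 69%:R / 100%:R * nrm b.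
  by rewrite -scaleNr; apply: CC; simpc.
have PE (p q : B) : p = (2^-1 : R)%:C *: ((p + q) + (p - q)).
  rewrite addrACA subrr addr0 scalerDr -scalerDl -rmorphD.
  by rewrite -[2^-1]mul1r -splitr scale1r.
rewrite -/(L b) -/(L (L b)) -/(L (L (L b))) -/P (PE P ('i%C *: Q)).
rewrite nrmZr ger0_norm ?invr_ge0//.
have := nrmD (P + 'i%C *: Q) (P - 'i%C *: Q).
move: C1 C2; set n1 := nrm _; set n2 := nrm _; set n3 := nrm _; set n4 := nrm b.
lra.
Qed.

Lemma ideal_star_step (I : cstar_ideal B) z : ideal_set I (star z) ->
  exists z', [/\ ideal_set I (z - z'), ideal_set I (star z') &
    nrm z' ^+ 2 <= 97%:R / 100%:R * nrm z ^+ 2].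
Proof.
move=> Iz; have [z0|z0] := eqVneq (nrm z) 0.
  exists z; split=> //; first by rewrite subrr; exact: ideal0.
  by rewrite z0 expr0n/= mulr0.
have zp : 0 < nrm z by rewrite lt_def z0 nrm_ge0.
have [u uE] : {u | u = ((nrm z)^-1)%:C *: z} by eexists.
have zE : z = (nrm z)%:C *: u by rewrite uE scalerA -rmorphM divff ?scale1r.
have nu : nrm u = 1.
  by rewrite uE nrmZr ger0_norm ?invr_ge0 ?nrm_ge0// mulVf.
have Iu : ideal_set I (star u) by rewrite uE starZr; exact: idealZ.
have [a aE] : {a | a = star u ** u} by exists (star u ** u).
have sa : star a = a by rewrite aE starM starK.
have na : nrm a = 1 by rewrite aE nrm_cstar nu expr1n.
have Ia : ideal_set I a by rewrite aE; exact: idealMr.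
have [e eE] : {e | e = a - kap%:C *: (a ** (a ** a))} by eexists.
pose v := u - kap%:C *: (u ** (a ** a)).
have se : star e = e by rewrite eE starB starZr !starM sa starmulA.
have ne : nrm e <= 69%:R / 100%:R.
  have [->|e0] := eqVneq (nrm e) 0; first by lra.
  have ep : 0 < nrm e by rewrite lt_def e0 nrm_ge0.
  rewrite -(ler_pM2r ep) -expr2 -nrm_cstar se {1}eE starmulBl starmulZl.
  by rewrite -!starmulA selfadj_contract// na.
have svu : star v ** u = e.
  by rewrite starB starZr !starM sa starmulBl starmulZl -!starmulA -aE eE.
have vv : star v ** v = e - kap%:C *: (e ** (a ** a)).
  by rewrite {2}/v starmulBr starmulZr starmulA svu.
have nv : nrm v ^+ 2 <= 97%:R / 100%:R.
  rewrite -nrm_cstar vv; apply: le_trans (nrmD _ _) _.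
  have naa : nrm (a ** a) <= 1.
    by apply: le_trans (nrmM _ _) _; rewrite na mulr1.
  have ea : nrm (e ** (a ** a)) <= nrm e.
    by apply: le_trans (nrmM _ _) _; rewrite ler_piMr ?nrm_ge0.
  rewrite nrmN nrmZr ger0_norm; last by rewrite /kap; lra.
  by move: ea ne; rewrite /kap; set r1 := nrm (e ** _); set r2 := nrm e; lra.
exists ((nrm z)%:C *: v); split.
- rewrite {1}zE -scalerBr; apply: idealZ; rewrite /v subKr; apply: idealZ.
  by apply: idealMl; exact: idealMl.
- rewrite starZr; apply: idealZ.
  rewrite starB starZr -scaleN1r scalerA; apply: idealD => //.
  by apply: idealZ; rewrite starM; exact: idealMl.
- by rewrite nrmZr ger0_norm ?nrm_ge0// exprMn mulrC ler_wpM2r ?sqr_ge0.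
Qed.

(* Closed two-sided ideals are selfadjoint, so the involution passes to the
   quotient. For [x] in [I], iterating [ideal_star_step] from [star x] gives
   elements of the coset [star x + I] of arbitrarily small norm. *)
Lemma ideal_star (I : cstar_ideal B) x : ideal_set I x -> ideal_set I (star x).
Proof.
move=> Ix.
have step n : exists z, [/\ ideal_set I (star x - z), ideal_set I (star z) &
    nrm z ^+ 2 <= (97%:R / 100%:R) ^+ n * nrm (star x) ^+ 2].
  elim: n => [|n [z [Iz Isz nz]]].
    exists (star x); rewrite subrr starK expr0 mul1r.
    by split=> //; exact: ideal0.
  have [z' [Iz' Isz' nz']] := ideal_star_step Isz; exists z'; split => //.
    by rewrite -(subrK z (star x)) -addrA; exact: idealD.
  apply: le_trans nz' _; 
  by rewrite [_ ^+ n.+1]exprS -(mulrA (97%:R / 100%:R)) ler_wpM2l//; lra.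
rewrite ((closure_id _).1 (@ideal_closed _ _ I)) => U /nbhs_ballP[e /= e0 xeU].
have [r r0 eE] : exists2 r : R, 0 < r & e = r%:C.
  exists (complex.Re e); last by rewrite RRe_real ?gtr0_real.
  by rewrite -ltcR RRe_real ?gtr0_real.
have /cvgrPdist_lt/(_ (r ^+ 2 / (nrm (star x) ^+ 2 + 1))) : 
    (fun n => (97%:R / 100%:R) ^+ n : R) @ \oo --> (0 : R).
  by apply: cvg_expr; rewrite ger0_norm; lra.
have d0 : 0 < nrm (star x) ^+ 2 + 1 by rewrite ltr_wpDl// sqr_ge0.
case; first by rewrite divr_gt0// exprn_gt0.
move=> n _ /(_ n (leqnn n)) /=; rewrite sub0r normrN.
have [z [Iz _ nz]] := step n.
rewrite ger0_norm ?exprn_ge0//; last by lra.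
rewrite ltr_pdivlMr// => hn.
exists (star x - z); split=> //; apply: xeU.
rewrite -ball_normE /= subKr eE nrmE ltcR.
rewrite -(@ltr_pXn2r _ 2) ?nnegrE ?nrm_ge0 ?ltW//.
apply: le_lt_trans nz (le_lt_trans _ hn).
by rewrite ler_wpM2l ?exprn_ge0 ?lerDl//; lra.
Qed.

End IdealStar.

Section Quotient.
Variables (R : realType) (B : cstarType R) (I : cstar_ideal B).
Implicit Types x y : B.

Lemma idealN x : ideal_set I x -> ideal_set I (- x).
Proof. by rewrite -scaleN1r; exact: idealZ. Qed.

Definition ideal_rel : rel B := fun x y => `[< ideal_set I (x - y) >].

Lemma ideal_rel_equiv : equiv_class_of ideal_rel.
Proof.
split=> [x|x y|y x z].
- by apply/asboolP; rewrite subrr; exact: ideal0.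
- by apply/asboolP/asboolP => /idealN; rewrite opprB.
- move=> /asboolP xy /asboolP yz; apply/asboolP.
  by rewrite -(subrK y x) -addrA; exact: idealD.
Qed.

Canonical ideal_equiv := EquivRelPack ideal_rel_equiv.

(* The quotient of [B] by [I] is a *-algebra with the quotient topology. This
   is the topology of the quotient norm; the norm itself is not needed, since
   *-homomorphisms are purely algebraic. *)
Definition cquot : Type := quotient_topology {eq_quot ideal_equiv}%qT.

HB.instance Definition _ := Choice.on cquot.
HB.instance Definition _ := Quotient.on cquot.
HB.instance Definition _ := Topological.on cquot.

Definition cpi : B -> cquot := \pi_cquot%qT.

Lemma cpi_surj (X : cquot) : exists x, cpi x = X.
Proof. by exists (repr X); rewrite /cpi reprK. Qed.

Lemma cpiP x y : cpi x = cpi y <-> ideal_set I (x - y).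
Proof.
have P := @eqmodP _ ideal_equiv x y.
split=> [/P/asboolP //|xy]; exact/P/asboolP.
Qed.

Lemma repr_cpi x : ideal_set I (repr (cpi x) - x).
Proof. by apply/cpiP; rewrite /cpi reprK. Qed.

Let addq (X Y : cquot) := cpi (repr X + repr Y).
Let oppq (X : cquot) := cpi (- repr X).
Let scaleq (k : R[i]) (X : cquot) := cpi (k *: repr X).
Let mulq (X Y : cquot) := cpi (repr X ** repr Y).
Let starq (X : cquot) := cpi (star (repr X)).

Let addqE x y : addq (cpi x) (cpi y) = cpi (x + y).
Proof. by apply/cpiP; rewrite opprD addrACA; apply: idealD; exact: repr_cpi. Qed.

Let oppqE x : oppq (cpi x) = cpi (- x).
Proof. by apply/cpiP; rewrite -opprD; apply: idealN; exact: repr_cpi. Qed.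

Let scaleqE k x : scaleq k (cpi x) = cpi (k *: x).
Proof. by apply/cpiP; rewrite -scalerBr; apply: idealZ; exact: repr_cpi. Qed.

Let mulqE x y : mulq (cpi x) (cpi y) = cpi (x ** y).
Proof.
apply/cpiP; rewrite -(subrK (x ** repr (cpi y)) (_ ** _)) -addrA.
rewrite -starmulBl -starmulBr; apply: idealD.
  by apply: idealMr; exact: repr_cpi.
by apply: idealMl; exact: repr_cpi.
Qed.

Let starqE x : starq (cpi x) = cpi (star x).
Proof. by apply/cpiP; rewrite -starB; apply: ideal_star; exact: repr_cpi. Qed.

Let addqA : associative addq.
Proof.
move=> X Y Z; case: (cpi_surj X) (cpi_surj Y) (cpi_surj Z) => x <- [y <-] [z <-].
by rewrite !addqE addrA.
Qed.

Let addqC : commutative addq.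
Proof.
move=> X Y; case: (cpi_surj X) (cpi_surj Y) => x <- [y <-].
by rewrite !addqE addrC.
Qed.

Let add0q : left_id (cpi 0) addq.
Proof. by move=> X; case: (cpi_surj X) => x <-; rewrite addqE add0r. Qed.

Let addNq : left_inverse (cpi 0) oppq addq.
Proof. by move=> X; case: (cpi_surj X) => x <-; rewrite oppqE addqE addNr. Qed.

HB.instance Definition _ := GRing.isZmodule.Build cquot addqA addqC add0q addNq.

Let scaleqA k l (X : cquot) : scaleq k (scaleq l X) = scaleq (k * l) X.
Proof. by case: (cpi_surj X) => x <-; rewrite !scaleqE scalerA. Qed.

Let scale1q : left_id 1 scaleq.
Proof. by move=> X; case: (cpi_surj X) => x <-; rewrite scaleqE scale1r. Qed.

Let scaleqDr : right_distributive scaleq +%R.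
Proof.
move=> k X Y; case: (cpi_surj X) (cpi_surj Y) => x <- [y <-].
by rewrite [_ + _]addqE !scaleqE scalerDr -addqE.
Qed.

Let scaleqDl (X : cquot) : {morph scaleq^~ X : k l / k + l}.
Proof.
by move=> k l; case: (cpi_surj X) => x <-; rewrite !scaleqE scalerDl -addqE.
Qed.

HB.instance Definition _ := GRing.Zmodule_isLmodule.Build R[i] cquot
  scaleqA scale1q scaleqDr scaleqDl.

Let mulqA : associative mulq.
Proof.
move=> X Y Z; case: (cpi_surj X) (cpi_surj Y) (cpi_surj Z) => x <- [y <-] [z <-].
by rewrite !mulqE starmulA.
Qed.

Let mulqDl : left_distributive mulq +%R.
Proof.
move=> X Y Z; case: (cpi_surj X) (cpi_surj Y) (cpi_surj Z) => x <- [y <-] [z <-].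
by rewrite [_ + _]addqE !mulqE starmulDl -addqE.
Qed.

Let mulqDr : right_distributive mulq +%R.
Proof.
move=> X Y Z; case: (cpi_surj X) (cpi_surj Y) (cpi_surj Z) => x <- [y <-] [z <-].
by rewrite [_ + _]addqE !mulqE starmulDr -addqE.
Qed.

Let mulqZl (k : R[i]) (X Y : cquot) : mulq (k *: X) Y = k *: mulq X Y.
Proof.
case: (cpi_surj X) (cpi_surj Y) => x <- [y <-].
by rewrite [k *: _]scaleqE !mulqE starmulZl -scaleqE.
Qed.

Let mulqZr (k : R[i]) (X Y : cquot) : mulq X (k *: Y) = k *: mulq X Y.
Proof.
case: (cpi_surj X) (cpi_surj Y) => x <- [y <-].
by rewrite [k *: _]scaleqE !mulqE starmulZr -scaleqE.
Qed.

Let starqK : involutive starq.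
Proof. by move=> X; case: (cpi_surj X) => x <-; rewrite !starqE starK. Qed.

Let starqD : {morph starq : X Y / X + Y}.
Proof.
move=> X Y; case: (cpi_surj X) (cpi_surj Y) => x <- [y <-].
by rewrite [_ + _]addqE !starqE starD -addqE.
Qed.

Let starqZ (k : R[i]) (X : cquot) : starq (k *: X) = (k^*)%C *: starq X.
Proof.
by case: (cpi_surj X) => x <-; rewrite [k *: _]scaleqE !starqE starZ -scaleqE.
Qed.

Let starqM (X Y : cquot) : starq (mulq X Y) = mulq (starq Y) (starq X).
Proof.
case: (cpi_surj X) (cpi_surj Y) => x <- [y <-].
by rewrite mulqE !starqE starM mulqE.
Qed.

HB.instance Definition _ := isStarAlg.Build R cquot
  mulqA mulqDl mulqDr mulqZl mulqZr starqK starqD starqZ starqM.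

Lemma cpi_starhom : is_starhom (cpi : B -> cquot).
Proof.
split=> [k x y|x y|x].
- by rewrite -addqE -scaleqE.
- by rewrite -mulqE.
- by rewrite -starqE.
Qed.

End Quotient.

(* The canonical map from B/I to B/J for I included in J, see [cquot_mapE]. *)
Definition cquot_map (R : realType) (B : cstarType R) (I J : cstar_ideal B)
  (X : cquot I) : cquot J := cpi J (repr X).

Lemma cquot_mapE (R : realType) (B : cstarType R) (I J : cstar_ideal B) x :
  I `<=` J -> cquot_map J (cpi I x) = cpi J x.
Proof. by move=> IJ; apply/cpiP/IJ/repr_cpi. Qed.

Section ComplexAux.
Variable R : rcfType.

Lemma complex_gt0P (e : R[i]) : 0 < e -> exists2 r : R, 0 < r & e = r%:C.
Proof.
move=> e0; exists (complex.Re e); last by rewrite RRe_real ?gtr0_real.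
by rewrite -ltcR RRe_real ?gtr0_real.
Qed.

Lemma absRe_normc (z : R[i]) : `|complex.Re z| <= normc z.
Proof.
by case: z => a b /=; rewrite -sqrtr_sqr ler_wsqrtr// lerDl sqr_ge0.
Qed.

Lemma absIm_normc (z : R[i]) : `|complex.Im z| <= normc z.
Proof.
by case: z => a b /=; rewrite -sqrtr_sqr ler_wsqrtr// lerDr sqr_ge0.
Qed.

Lemma normc_le (z : R[i]) : normc z <= `|complex.Re z| + `|complex.Im z|.
Proof.
case: z => a b /=; rewrite -(@ler_pXn2r _ 2) ?nnegrE ?sqrtr_ge0 ?addr_ge0//.
rewrite sqr_sqrtr ?addr_ge0 ?sqr_ge0// sqrrD !real_normK ?num_real//.
by rewrite addrAC lerDl mulrn_wge0// mulr_ge0.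
Qed.

End ComplexAux.

Section EuclideanNorm.
Variables (R : realType) (n : nat).
Implicit Types u v w : 'cV[R[i]]_n.

Definition dotv u v : R[i] := \sum_i ((u i 0)^*)%C * v i 0.

Definition vnorm v : R := Num.sqrt (\sum_i normc (v i 0) ^+ 2).

Lemma normcE_R (k : R[i]) : `|k| = (normc k)%:C.
Proof. by []. Qed.

Lemma vnorm_ge0 v : 0 <= vnorm v.
Proof. exact: sqrtr_ge0. Qed.

Lemma vnorm_sqr v : vnorm v ^+ 2 = \sum_i normc (v i 0) ^+ 2.
Proof. by rewrite sqr_sqrtr// sumr_ge0// => i _; rewrite sqr_ge0. Qed.

Lemma dotvv v : dotv v v = ((vnorm v) ^+ 2)%:C.
Proof.
rewrite vnorm_sqr rmorph_sum; apply: eq_bigr => i _.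
by rewrite rmorphXn/= -normcE_R sqr_normc mulrC.
Qed.

Lemma dotvE u v : dotv u v = dotmx v^T u^T.
Proof.
by rewrite dotmxE mxE; apply: eq_bigr => i _; rewrite !mxE mulrC.
Qed.

Lemma dotv_le u v : normc (dotv u v) <= vnorm u * vnorm v.
Proof.
have H : `|dotmx v^T u^T| ^+ 2 <= dotmx v^T v^T * dotmx u^T u^T.
  exact: (CauchySchwarz (@dotmx R[i] n) v^T u^T).1.
rewrite -(@ler_pXn2r _ 2) ?nnegrE ?normc_ge0 ?mulr_ge0 ?vnorm_ge0//.
by move: H; rewrite -!dotvE !dotvv -rmorphM/= -rmorphXn/= lecR mulrC exprMn.
Qed.

Lemma normc_dotvv v : normc (dotv v v) = vnorm v ^+ 2.
Proof. by rewrite dotvv normc_real ger0_norm ?sqr_ge0. Qed.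

Lemma vnormD u v : vnorm (u + v) <= vnorm u + vnorm v.
Proof.
have [->|z] := eqVneq (vnorm (u + v)) 0; first by rewrite addr_ge0 ?vnorm_ge0.
have zp : 0 < vnorm (u + v) by rewrite lt_def z vnorm_ge0.
rewrite -(ler_pM2l zp) -expr2 -normc_dotvv mulrDr.
have -> : dotv (u + v) (u + v) = dotv (u + v) u + dotv (u + v) v.
  by rewrite -big_split; apply: eq_bigr => i _; rewrite !mxE mulrDr.
by apply: le_trans (le_normcD _ _) _; rewrite lerD ?dotv_le.
Qed.

Lemma vnormZ k v : vnorm (k *: v) = normc k * vnorm v.
Proof.
apply/eqP; rewrite -(@eqrXn2 _ 2) ?mulr_ge0 ?vnorm_ge0 ?normc_ge0//.
rewrite exprMn !vnorm_sqr mulr_sumr; apply/eqP/eq_bigr => i _.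
by rewrite mxE normcM exprMn.
Qed.

Lemma vnorm0 : vnorm 0 = 0.
Proof. by rewrite -(scale0r 0) vnormZ normc0 mul0r. Qed.

Lemma vnorm_entry v i : normc (v i 0) <= vnorm v.
Proof.
rewrite -(@ler_pXn2r _ 2) ?nnegrE ?normc_ge0 ?vnorm_ge0//.
rewrite vnorm_sqr (bigD1 i)//= lerDl sumr_ge0// => j _; exact: sqr_ge0.
Qed.

Lemma vnorm0_eq0 v : vnorm v = 0 -> v = 0.
Proof.
move=> v0; apply/colP => i; rewrite mxE; apply: eq0_normc.
by apply/eqP; rewrite eq_le normc_ge0 -v0 vnorm_entry.
Qed.

Lemma vnorm_delta i : vnorm (delta_mx i 0) = 1.
Proof.
apply/eqP; rewrite -(@eqrXn2 _ 2) ?vnorm_ge0// vnorm_sqr (bigD1 i)//= big1.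
  by rewrite mxE !eqxx normc1 addr0.
by move=> j /negbTE ji; rewrite mxE ji andFb normc0 expr0n.
Qed.

Lemma vnorm_le_sum v : vnorm v <= \sum_i normc (v i 0).
Proof.
rewrite {1}(_ : v = \sum_i v i 0 *: delta_mx i 0); last first.
  apply/colP => j; rewrite summxE (bigD1 j)//= big1.
    by rewrite !mxE !eqxx mulr1 addr0.
  by move=> i /negbTE ij; rewrite !mxE eq_sym ij mulr0.
elim/big_ind2 : _ => [|x a y b xa yb|i _].
- by rewrite vnorm0.
- by apply: le_trans (vnormD _ _) _; exact: lerD.
- by rewrite vnormZ vnorm_delta mulr1.
Qed.

End EuclideanNorm.

Section OperatorNorm.
Variables (R : realType) (n : nat).
Implicit Types (M N : 'M[R[i]]_n) (u v w : 'cV[R[i]]_n).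

(* The norm of [M] acting on column vectors with the Euclidean norm. *)
Definition opnorm M : R := sup [set vnorm (M *m v) | v in [set v | vnorm v <= 1]].

Definition adjmx M : 'M[R[i]]_n := map_mx conjc M^T.

Lemma dotv_adj M u v : dotv (M *m u) v = dotv u (adjmx M *m v).
Proof.
rewrite /dotv.
under eq_bigr do rewrite mxE rmorph_sum mulr_suml.
under [RHS]eq_bigr do rewrite mxE mulr_sumr.
rewrite exchange_big; apply: eq_bigr => i _; apply: eq_bigr => j _.
by rewrite !mxE rmorphM mulrCA mulrA.
Qed.

Lemma adjmxK : involutive adjmx.
Proof. by move=> M; apply/matrixP => i j; rewrite !mxE conjcK. Qed.

Lemma adjmxM M N : adjmx (M *m N) = adjmx N *m adjmx M.
Proof. by rewrite /adjmx trmx_mul map_mxM. Qed.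

Let K M := \sum_i \sum_j normc (M i j).

Let vnorm_mulmx M v : vnorm (M *m v) <= K M * vnorm v.
Proof.
apply: le_trans (vnorm_le_sum _) _; rewrite mulr_suml ler_sum// => i _.
rewrite mxE mulr_suml.
elim/big_ind2 : _ => [|x a y b xa yb|j _].
- by rewrite normc0.
- by apply: le_trans (le_normcD _ _) _; exact: lerD.
- by rewrite normcM ler_wpM2l ?normc_ge0 ?vnorm_entry.
Qed.

Let K_ge0 M : 0 <= K M.
Proof. by rewrite sumr_ge0// => i _; rewrite sumr_ge0// => j _; exact: normc_ge0. Qed.

Let opnorm_sup M v : vnorm v <= 1 -> vnorm (M *m v) <= opnorm M.
Proof.
move=> v1; apply: ub_le_sup; last by exists v.
exists (K M) => _ [w /= w1 <-]; apply: le_trans (vnorm_mulmx _ _) _.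
by rewrite ler_piMr.
Qed.

Lemma opnorm_ge0 M : 0 <= opnorm M.
Proof.
by rewrite -(vnorm0 R n) -(mulmx0 _ M) opnorm_sup// vnorm0.
Qed.

Lemma opnorm_le M v : vnorm (M *m v) <= opnorm M * vnorm v.
Proof.
have [v0|v0] := eqVneq (vnorm v) 0.
  by rewrite (vnorm0_eq0 v0) mulmx0 vnorm0 mulr0.
have vp : 0 < vnorm v by rewrite lt_def v0 vnorm_ge0.
have nv : `|(vnorm v)^-1| = (vnorm v)^-1 by rewrite ger0_norm ?invr_ge0 ?ltW.
have := @opnorm_sup M (((vnorm v)^-1)%:C *: v).
rewrite -scalemxAr !vnormZ normc_real nv mulVf// => /(_ (lexx _)).
by rewrite mulrC ler_pdivrMr.
Qed.

Lemma opnorm_lub M (c : R) : 0 <= c ->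
  (forall v, vnorm (M *m v) <= c * vnorm v) -> opnorm M <= c.
Proof.
move=> c0 Mc; apply: ge_sup; first by exists (vnorm (M *m 0)), 0; rewrite //= vnorm0.
by move=> _ [v /= v1 <-]; apply: le_trans (Mc v) _; rewrite ler_piMr.
Qed.

Lemma opnorm_entry M i j : normc (M i j) <= opnorm M.
Proof.
have := opnorm_le M (delta_mx j 0); rewrite vnorm_delta mulr1.
apply: le_trans; rewrite -colE.
by have := vnorm_entry (col j M) i; rewrite mxE.
Qed.

Lemma opnorm_le_sum M : opnorm M <= \sum_i \sum_j normc (M i j).
Proof. by apply: opnorm_lub => [|v]; [exact: K_ge0|exact: vnorm_mulmx]. Qed.

Lemma opnormD M N : opnorm (M + N) <= opnorm M + opnorm N.
Proof.
apply: opnorm_lub => [|v]; first by rewrite addr_ge0 ?opnorm_ge0.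
by rewrite mulmxDl mulrDl; apply: le_trans (vnormD _ _) _; rewrite lerD ?opnorm_le.
Qed.

Let opnormZ_le k M : opnorm (k *: M) <= normc k * opnorm M.
Proof.
apply: opnorm_lub => [|v]; first by rewrite mulr_ge0 ?normc_ge0 ?opnorm_ge0.
by rewrite -scalemxAl vnormZ -mulrA ler_wpM2l ?normc_ge0 ?opnorm_le.
Qed.

Lemma opnorm0_eq0 M : opnorm M = 0 -> M = 0.
Proof.
move=> M0; apply/matrixP => i j; rewrite mxE; apply: eq0_normc.
by apply/eqP; rewrite eq_le normc_ge0 -M0 opnorm_entry.
Qed.

Lemma opnormZ k M : opnorm (k *: M) = normc k * opnorm M.
Proof.
have [->|k0] := eqVneq k 0.
  apply/eqP; rewrite eq_le opnormZ_le scale0r normc0 mul0r opnorm_ge0.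
  by [].
apply/eqP; rewrite eq_le opnormZ_le/=.
have nk : 0 < normc k.
  by rewrite lt_def normc_ge0 andbT; apply: contra_neq k0 => /eq0_normc.
have := opnormZ_le k^-1 (k *: M).
by rewrite scalerA mulVf// scale1r normcV mulrC ler_pdivlMr// mulrC.
Qed.

Lemma opnormM M N : opnorm (M *m N) <= opnorm M * opnorm N.
Proof.
apply: opnorm_lub => [|v]; first by rewrite mulr_ge0 ?opnorm_ge0.
rewrite -mulmxA; apply: le_trans (opnorm_le _ _) _.
by rewrite -mulrA ler_wpM2l ?opnorm_ge0 ?opnorm_le.
Qed.

Let vnorm_adj_sqr M v :
  vnorm (M *m v) ^+ 2 <= vnorm v * vnorm (adjmx M *m (M *m v)).
Proof. by rewrite -normc_dotvv dotv_adj dotv_le. Qed.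

Let opnorm_adj_le M : opnorm (adjmx M) <= opnorm M.
Proof.
apply: opnorm_lub => [|v]; first exact: opnorm_ge0.
have [->|z] := eqVneq (vnorm (adjmx M *m v)) 0.
  by rewrite mulr_ge0 ?opnorm_ge0 ?vnorm_ge0.
have zp : 0 < vnorm (adjmx M *m v) by rewrite lt_def z vnorm_ge0.
rewrite -(ler_pM2r zp) -expr2; apply: le_trans (vnorm_adj_sqr _ _) _.
rewrite adjmxK [opnorm M * _]mulrC -mulrA ler_wpM2l ?vnorm_ge0//.
exact: opnorm_le.
Qed.

Lemma opnorm_adj M : opnorm (adjmx M) = opnorm M.
Proof.
by apply/eqP; rewrite eq_le opnorm_adj_le -{1}[M]adjmxK opnorm_adj_le.
Qed.

Lemma opnorm_cstar M : opnorm (adjmx M *m M) = opnorm M ^+ 2.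
Proof.
apply/eqP; rewrite eq_le; apply/andP; split.
  by rewrite expr2 -{1}(opnorm_adj M) opnormM.
set c := opnorm (adjmx M *m M).
have c0 : 0 <= c := opnorm_ge0 _.
rewrite -[c]sqr_sqrtr// ler_pXn2r ?nnegrE ?sqrtr_ge0 ?opnorm_ge0//.
apply: opnorm_lub => [|v]; first exact: sqrtr_ge0.
rewrite -(@ler_pXn2r _ 2) ?nnegrE ?mulr_ge0 ?vnorm_ge0 ?sqrtr_ge0//.
rewrite exprMn (sqr_sqrtr c0); apply: le_trans (vnorm_adj_sqr _ _) _.
rewrite mulmxA [c * _]mulrC expr2 -mulrA ler_wpM2l ?vnorm_ge0//.
by rewrite mulrC opnorm_le.
Qed.

End OperatorNorm.

(* An alias, because ['M[R[i]]_n] already carries the max norm. *)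
Definition mxalg (R : realType) (n : nat) : Type := 'M[R[i]]_n.

Section MatrixAlgebra.
Variables (R : realType) (n : nat).
Local Notation A := (mxalg R n).

HB.instance Definition _ := GRing.Lmodule.copy A 'M[R[i]]_n.

Let norm (M : A) : R[i] := (opnorm M)%:C.

Let normD (M N : A) : norm (M + N) <= norm M + norm N.
Proof. by rewrite -rmorphD/= lecR; exact: opnormD. Qed.

Let normZ (k : R[i]) (M : A) : norm (k *: M) = `|k| * norm M.
Proof. by rewrite /norm opnormZ rmorphM. Qed.

Let norm0 (M : A) : norm M = 0 -> M = 0.
Proof. by move=> /complexI; exact: opnorm0_eq0. Qed.

HB.instance Definition _ := Lmodule_isNormed.Build R[i] A normD normZ norm0.

Lemma nrm_mxalg (M : A) : nrm M = opnorm M.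
Proof. by []. Qed.

Let mulmxA' : associative (fun M N : A => M *m N : A).
Proof. by move=> x y z; exact: mulmxA. Qed.

Let mulDl : left_distributive (fun M N : A => M *m N : A) +%R.
Proof. by move=> x y z; exact: mulmxDl. Qed.

Let mulDr : right_distributive (fun M N : A => M *m N : A) +%R.
Proof. by move=> x y z; exact: mulmxDr. Qed.

Let mulZl (k : R[i]) (x y : A) : (k *: x : A) *m y = k *: (x *m y : A) :> A.
Proof. by apply/esym; exact: scalemxAl. Qed.

Let mulZr (k : R[i]) (x y : A) : x *m (k *: y : A) = k *: (x *m y : A) :> A.
Proof. by apply/esym; exact: scalemxAr. Qed.

Let adjD : {morph (@adjmx R n : A -> A) : x y / x + y}.
Proof. by move=> x y; apply/matrixP => i j; rewrite !mxE rmorphD. Qed.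

Let adjZ (k : R[i]) (x : A) : adjmx (k *: x) = (k^*)%C *: (adjmx x : A) :> A.
Proof. by apply/matrixP => i j; rewrite !mxE rmorphM. Qed.

HB.instance Definition _ := isStarAlg.Build R A
  mulmxA' mulDl mulDr mulZl mulZr (@adjmxK R n) adjD adjZ (@adjmxM R n).

Let mxalg_complete (F : set_system A) : ProperFilter F -> cauchy F -> cvg F.
Proof.
move=> FF /cauchy_ballP Fc.
have cf (f : A -> R) : (forall x y, `|f x - f y| <= nrm (x - y)) ->
    exists l : R, f @ F --> l.
  move=> fle; suff: cvg (f @ F) by move/cvg_ex.
  apply: R_complete; apply/cauchy_ballP => e e0.
  have H : \forall x & y \near F, ball x e%:C y by apply: Fc; rewrite ltcR.
  rewrite near_map2; apply: filterS H => -[x y] /=.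
  by rewrite -!ball_normE /= nrmE ltcR; exact: le_lt_trans.
have fin2 (x y : A) i j :
    ((x - y : A) : 'M_n) i j = (x : 'M_n) i j - (y : 'M_n) i j.
  by rewrite !mxE.
have reim (ij : 'I_n * 'I_n) : exists l : R[i], forall e : R, 0 < e ->
    \forall x \near F, normc (l - (x : 'M_n) ij.1 ij.2) < e.
  case: ij => i j /=.
  have [|a /cvgrPdist_lt Fa] := cf (fun x => complex.Re ((x : 'M_n) i j)).
    move=> x y; rewrite -(raddfB (@complex.Re R : Rcomplex R -> R)) -fin2.
    by apply: le_trans (absRe_normc _) (opnorm_entry _ _ _).
  have [|b /cvgrPdist_lt Fb] := cf (fun x => complex.Im ((x : 'M_n) i j)).
    move=> x y; rewrite -(raddfB (@complex.Im R : Rcomplex R -> R)) -fin2.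
    by apply: le_trans (absIm_normc _) (opnorm_entry _ _ _).
  exists (a +i* b) => e e0; have e20 : 0 < e / 2 by rewrite divr_gt0.
  near=> x; apply: le_lt_trans (normc_le _) _.
  rewrite [e]splitr (raddfB (@complex.Re R : Rcomplex R -> R)).
  rewrite (raddfB (@complex.Im R : Rcomplex R -> R)) /= ltrD//.
    by near: x; exact: Fa.
  by near: x; exact: Fb.
pose L : A := (\matrix_(i, j) sval (cid (reim (i, j)))).
apply/cvg_ex; exists L; apply/cvgrPdist_lt => _ /complex_gt0P[r r0 ->].
pose d := r / (n%:R * n%:R + 1).
have d0 : 0 < d by rewrite divr_gt0// ltr_wpDl// mulr_ge0.
have H : \forall x \near F, forall ij : 'I_n * 'I_n,
    normc (L ij.1 ij.2 - (x : 'M_n) ij.1 ij.2) < d.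
  apply: filter_forall => -[i j]; rewrite /L mxE /=.
  by case: cid => l /= lP; exact: lP.
near=> x; rewrite nrmE ltcR.
have Hx : forall ij : 'I_n * 'I_n,
    normc (L ij.1 ij.2 - (x : 'M_n) ij.1 ij.2) < d by near: x.
apply: (@le_lt_trans _ _ (n%:R * n%:R * d)).
  apply: le_trans (opnorm_le_sum _) _.
  apply: (@le_trans _ _ (\sum_(i < n) \sum_(j < n) d)).
    apply: ler_sum => i _; apply: ler_sum => j _.
    by rewrite fin2; exact/ltW/(Hx (i, j)).
  by rewrite !sumr_const card_ord -[_ *+ n *+ n]mulr_natl -[d *+ n]mulr_natl mulrA.
have nn : 0 < n%:R * n%:R + 1 :> R by rewrite ltr_wpDl// mulr_ge0.
by rewrite /d mulrCA gtr_pMr// ltr_pdivrMr// mul1r ltrDl.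
Unshelve. all: by end_near. Qed.

HB.instance Definition _ := Uniform_isComplete.Build A mxalg_complete.

Let mxalg_normM (x y : A) : `|x ** y| <= `|x| * `|y|.
Proof. by rewrite !nrmE -rmorphM/= lecR; exact: opnormM. Qed.

Let mxalg_cstar (x : A) : `|star x ** x| = `|x| ^+ 2.
Proof. by rewrite !nrmE -rmorphXn/=; congr (_%:C); exact: opnorm_cstar. Qed.

HB.instance Definition _ := isCStarAlg.Build R A mxalg_normM mxalg_cstar.

End MatrixAlgebra.

Section BoundedProduct.
Variables (R : realType) (B : nat -> cstarType R).

(* The bounded sequences, with the supremum norm. *)
Record bprod : Type := BProd {
  bprod_fun :> forall i, B i;
  bprod_bounded : exists K : R, forall i, nrm (bprod_fun i) <= K
}.

Lemma bprod_ext (x y : bprod) : (forall i, x i = y i) -> x = y.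
Proof.
case: x y => [x xb] [y yb] /= xy.
have {}xy : x = y by apply: functional_extensionality_dep.
by subst y; rewrite (Prop_irrelevance xb yb).
Qed.

HB.instance Definition _ := gen_eqMixin bprod.
HB.instance Definition _ := gen_choiceMixin bprod.

Let zero_bounded : exists K : R, forall i, nrm (0 : B i) <= K.
Proof. by exists 0 => i; rewrite nrm0. Qed.

Let add_bounded (x y : bprod) : exists K : R, forall i, nrm (x i + y i) <= K.
Proof.
case: (bprod_bounded x) (bprod_bounded y) => K xK [L yL]; exists (K + L) => i.
by apply: le_trans (nrmD _ _) _; exact: lerD.
Qed.

Let opp_bounded (x : bprod) : exists K : R, forall i, nrm (- x i) <= K.
Proof.
by case: (bprod_bounded x) => K xK; exists K => i; rewrite nrmN.
Qed.

Let scale_bounded (k : R[i]) (x : bprod) :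
  exists K : R, forall i, nrm (k *: x i) <= K.
Proof.
case: (bprod_bounded x) => K xK; exists (normc k * K) => i.
by rewrite nrmZ ler_wpM2l ?normc_ge0.
Qed.

Let mul_bounded (x y : bprod) : exists K : R, forall i, nrm (x i ** y i) <= K.
Proof.
case: (bprod_bounded x) (bprod_bounded y) => K xK [L yL]; exists (K * L) => i.
by apply: le_trans (nrmM _ _) _; rewrite ler_pM ?nrm_ge0.
Qed.

Let star_bounded (x : bprod) : exists K : R, forall i, nrm (star (x i)) <= K.
Proof.
by case: (bprod_bounded x) => K xK; exists K => i; rewrite nrm_star.
Qed.

Let bzero : bprod := BProd zero_bounded.
Let badd (x y : bprod) : bprod := BProd (add_bounded x y).
Let bopp (x : bprod) : bprod := BProd (opp_bounded x).
Let bscale (k : R[i]) (x : bprod) : bprod := BProd (scale_bounded k x).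
Let bmul (x y : bprod) : bprod := BProd (mul_bounded x y).
Let bstar (x : bprod) : bprod := BProd (star_bounded x).

Let baddA : associative badd.
Proof. by move=> x y z; apply: bprod_ext => i /=; rewrite addrA. Qed.
Let baddC : commutative badd.
Proof. by move=> x y; apply: bprod_ext => i /=; rewrite addrC. Qed.
Let badd0 : left_id bzero badd.
Proof. by move=> x; apply: bprod_ext => i /=; rewrite add0r. Qed.
Let baddN : left_inverse bzero bopp badd.
Proof. by move=> x; apply: bprod_ext => i /=; rewrite addNr. Qed.

HB.instance Definition _ := GRing.isZmodule.Build bprod baddA baddC badd0 baddN.

Let bscaleA k l (x : bprod) : bscale k (bscale l x) = bscale (k * l) x.
Proof. by apply: bprod_ext => i /=; rewrite scalerA. Qed.
Let bscale1 : left_id 1 bscale.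
Proof. by move=> x; apply: bprod_ext => i /=; rewrite scale1r. Qed.
Let bscaleDr : right_distributive bscale +%R.
Proof. by move=> k x y; apply: bprod_ext => i /=; rewrite scalerDr. Qed.
Let bscaleDl (x : bprod) : {morph bscale^~ x : k l / k + l}.
Proof. by move=> k l; apply: bprod_ext => i /=; rewrite scalerDl. Qed.

HB.instance Definition _ := GRing.Zmodule_isLmodule.Build R[i] bprod
  bscaleA bscale1 bscaleDr bscaleDl.

Let bmulA : associative bmul.
Proof. by move=> x y z; apply: bprod_ext => i /=; rewrite starmulA. Qed.
Let bmulDl : left_distributive bmul +%R.
Proof. by move=> x y z; apply: bprod_ext => i /=; rewrite starmulDl. Qed.
Let bmulDr : right_distributive bmul +%R.
Proof. by move=> x y z; apply: bprod_ext => i /=; rewrite starmulDr. Qed.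
Let bmulZl (k : R[i]) (x y : bprod) : bmul (k *: x) y = k *: bmul x y.
Proof. by apply: bprod_ext => i /=; rewrite starmulZl. Qed.
Let bmulZr (k : R[i]) (x y : bprod) : bmul x (k *: y) = k *: bmul x y.
Proof. by apply: bprod_ext => i /=; rewrite starmulZr. Qed.
Let bstarK : involutive bstar.
Proof. by move=> x; apply: bprod_ext => i /=; rewrite starK. Qed.
Let bstarD : {morph bstar : x y / x + y}.
Proof. by move=> x y; apply: bprod_ext => i /=; rewrite starD. Qed.
Let bstarZ (k : R[i]) (x : bprod) : bstar (k *: x) = (k^*)%C *: bstar x.
Proof. by apply: bprod_ext => i /=; rewrite starZ. Qed.
Let bstarM (x y : bprod) : bstar (bmul x y) = bmul (bstar y) (bstar x).
Proof. by apply: bprod_ext => i /=; rewrite starM. Qed.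

HB.instance Definition _ := isStarAlg.Build R bprod
  bmulA bmulDl bmulDr bmulZl bmulZr bstarK bstarD bstarZ bstarM.

Definition supnorm (x : bprod) : R := sup (range (fun i => nrm (x i))).

Lemma supnorm_ub (x : bprod) i : nrm (x i) <= supnorm x.
Proof.
apply: ub_le_sup; last by exists i.
by case: (bprod_bounded x) => K xK; exists K => _ [j _ <-].
Qed.

Lemma supnorm_lub (x : bprod) (c : R) :
  (forall i, nrm (x i) <= c) -> supnorm x <= c.
Proof.
move=> xc; apply: ge_sup; first by exists (nrm (x 0%N)), 0%N.
by move=> _ [i _ <-].
Qed.

Lemma supnorm_ge0 (x : bprod) : 0 <= supnorm x.
Proof. by apply: le_trans (nrm_ge0 _) (supnorm_ub x 0). Qed.

Let norm (x : bprod) : R[i] := (supnorm x)%:C.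

Let normD (x y : bprod) : norm (x + y) <= norm x + norm y.
Proof.
rewrite -rmorphD/= lecR; apply: supnorm_lub => i.
by apply: le_trans (nrmD _ _) _; rewrite lerD ?supnorm_ub.
Qed.

Let supnormZ_le k (x : bprod) : supnorm (k *: x) <= normc k * supnorm x.
Proof.
by apply: supnorm_lub => i; rewrite nrmZ ler_wpM2l ?normc_ge0 ?supnorm_ub.
Qed.

Let norm0 (x : bprod) : norm x = 0 -> x = 0.
Proof.
move=> /complexI x0; apply: bprod_ext => i; apply: nrm0_eq0.
by apply/eqP; rewrite eq_le nrm_ge0 -x0 supnorm_ub.
Qed.

Let normZ (k : R[i]) (x : bprod) : norm (k *: x) = `|k| * norm x.
Proof.
rewrite normcE_R -rmorphM; congr (_%:C); apply/eqP; rewrite eq_le supnormZ_le/=.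
have [->|k0] := eqVneq k 0; first by rewrite normc0 mul0r supnorm_ge0.
have nk : 0 < normc k.
  by rewrite lt_def normc_ge0 andbT; apply: contra_neq k0 => /eq0_normc.
have := supnormZ_le k^-1 (k *: x).
by rewrite scalerA mulVf// scale1r normcV mulrC ler_pdivlMr// mulrC.
Qed.

HB.instance Definition _ := Lmodule_isNormed.Build R[i] bprod normD normZ norm0.

Lemma nrm_bprod (x : bprod) : nrm x = supnorm x.
Proof. by []. Qed.

Let bprod_complete (F : set_system bprod) :
  ProperFilter F -> cauchy F -> cvg F.
Proof.
move=> FF /cauchy_ballP Fc.
have cb (e : R) : 0 < e -> \forall x & y \near F, nrm (x - y) < e.
  move=> e0; have : \forall x & y \near F, ball x e%:C y.
    by apply: Fc; rewrite ltcR.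
  by apply: filterS => -[x y]; rewrite -ball_normE /= nrmE ltcR.
have ci i : exists l : B i, (fun x : bprod => x i) @ F --> l.
  suff: cvg ((fun x : bprod => x i) @ F) by move/cvg_ex.
  apply: cauchy_cvg; apply/cauchy_ballP => _ /complex_gt0P[e e0 ->].
  rewrite near_map2; apply: filterS (cb e e0) => -[x y] /=.
  rewrite -!ball_normE /= nrmE ltcR; apply: le_lt_trans.
  exact: (supnorm_ub (x - y) i).
pose l i : B i := sval (cid (ci i)).
have lP i : (fun x : bprod => x i) @ F --> l i by rewrite /l; case: cid.
have close (e : R) : 0 < e ->
    \forall x \near F, forall i, nrm (l i - (x : bprod) i) <= e.
  move=> e0; have H := cb (e / 2) (divr_gt0 e0 (ltr0Sn _ 1)).
  have H1 : \forall x \near F, \forall y \near F, nrm (x - y) < e / 2.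
    exact: nearP_dep H.
  apply: filterS H1 => x Hx i.
  have e20 : 0 < (e / 2)%:C by rewrite ltcR divr_gt0.
  have /cvgrPdist_lt/(_ _ e20) Hl := lP i.
  near F => y.
  rewrite -(subrK (y i) (l i)) -addrA; apply: le_trans (nrmD _ _) _.
  rewrite [e]splitr lerD//.
    rewrite ltW// -ltcR -nrmE; near: y; exact: Hl.
  rewrite nrmB; apply: le_trans (supnorm_ub (x - y) i) _.
  by rewrite ltW//; near: y; exact: Hx.
have lb : exists K : R, forall i, nrm (l i) <= K.
  have [x Hx] := filter_ex (close 1 ltr01).
  have [K xK] := bprod_bounded x; exists (1 + K) => i.
  rewrite -(subrK (x i) (l i)); apply: le_trans (nrmD _ _) _.
  by rewrite lerD.
apply/cvg_ex; exists (BProd lb).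
apply/cvgrPdist_lt => _ /complex_gt0P[e e0 ->].
have e20 : 0 < e / 2 by rewrite divr_gt0.
apply: filterS (close _ e20) => x Hx; rewrite nrmE ltcR.
apply: (@le_lt_trans _ _ (e / 2)); last by rewrite ltr_pdivrMr// ltr_pMr// ltr1n.
by apply: supnorm_lub => i; exact: Hx.
Unshelve. all: by end_near. Qed.

HB.instance Definition _ := Uniform_isComplete.Build bprod bprod_complete.

Let bprod_normM (x y : bprod) : `|x ** y| <= `|x| * `|y|.
Proof.
rewrite !nrmE -rmorphM/= lecR; apply: supnorm_lub => i.
by apply: le_trans (nrmM _ _) _; rewrite ler_pM ?nrm_ge0 ?supnorm_ub.
Qed.

Let bprod_cstar (x : bprod) : `|star x ** x| = `|x| ^+ 2.
Proof.
rewrite !nrmE -rmorphXn/=; congr (_%:C); apply/eqP; rewrite eq_le.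
apply/andP; split.
  apply: supnorm_lub => i; rewrite [nrm _](nrm_cstar (x i)).
  by rewrite ler_pXn2r ?nnegrE ?nrm_ge0 ?supnorm_ub.
set c := nrm (star x ** x); have c0 : 0 <= c := nrm_ge0 _.
rewrite -[c]sqr_sqrtr// ler_pXn2r ?nnegrE ?sqrtr_ge0 ?nrm_ge0//.
apply: supnorm_lub => i.
rewrite -(@ler_pXn2r _ 2) ?nnegrE ?nrm_ge0 ?sqrtr_ge0// (sqr_sqrtr c0).
by rewrite -nrm_cstar; exact: (supnorm_ub (star x ** x) i).
Qed.

HB.instance Definition _ := isCStarAlg.Build R bprod bprod_normM bprod_cstar.

Definition c0sum_set : set bprod :=
  [set x | (fun i => nrm (x i)) @ \oo --> (0 : R)].

Let c0sum_setP (x : bprod) : c0sum_set x <->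
  forall e : R, 0 < e -> \forall i \near \oo, nrm (x i) < e.
Proof.
split=> [/cvgrPdist_lt xe e e0|xe].
  by apply: filterS (xe e e0) => i; rewrite sub0r normrN ger0_norm ?nrm_ge0.
apply/cvgrPdist_lt => e /xe; apply: filterS => i.
by rewrite sub0r normrN ger0_norm ?nrm_ge0.
Qed.

Let c0sum_le (x : bprod) (y : bprod) (c : R) :
  (forall i, nrm (y i) <= c * nrm (x i)) -> c0sum_set x -> c0sum_set y.
Proof.
move=> yx /c0sum_setP x0; apply/c0sum_setP => e e0.
have c1 : 0 < `|c| + 1 by rewrite ltr_wpDl.
apply: filterS (x0 _ (divr_gt0 e0 c1)) => i; rewrite ltr_pdivlMr//.
apply: le_lt_trans; apply: le_trans (yx i) _; rewrite mulrC.
by rewrite ler_wpM2l ?nrm_ge0// (le_trans (ler_norm c))// lerDl.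
Qed.

Let c0sum0 : c0sum_set 0.
Proof. by apply/c0sum_setP => e e0; apply: nearW => i; rewrite nrm0. Qed.

Let c0sumD x y : c0sum_set x -> c0sum_set y -> c0sum_set (x + y).
Proof.
move=> /c0sum_setP x0 /c0sum_setP y0; apply/c0sum_setP => e e0.
have e20 : 0 < e / 2 by rewrite divr_gt0.
near=> i; apply: le_lt_trans (nrmD _ _) _; rewrite [e]splitr ltrD//.
  by near: i; exact: x0.
by near: i; exact: y0.
Unshelve. all: by end_near. Qed.

Let c0sumZ (k : R[i]) x : c0sum_set x -> c0sum_set (k *: x).
Proof. by apply: (@c0sum_le _ _ (normc k)) => i; rewrite nrmZ. Qed.

Let c0sumMl (b x : bprod) : c0sum_set x -> c0sum_set (b ** x).
Proof.
apply: (@c0sum_le _ _ (supnorm b)) => i; apply: le_trans (nrmM _ _) _.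
by rewrite ler_wpM2r ?nrm_ge0 ?supnorm_ub.
Qed.

Let c0sumMr (b x : bprod) : c0sum_set x -> c0sum_set (x ** b).
Proof.
apply: (@c0sum_le _ _ (supnorm b)) => i; apply: le_trans (nrmM _ _) _.
by rewrite mulrC ler_wpM2r ?nrm_ge0 ?supnorm_ub.
Qed.

Let c0sum_closed : closed c0sum_set.
Proof.
move=> x clx; apply/c0sum_setP => e e0.
have e20 : 0 < e / 2 by rewrite divr_gt0.
have [y [/c0sum_setP y0 xy]] : c0sum_set `&` ball x (e / 2)%:C !=set0.
  by apply: clx; apply: nbhsx_ballx; rewrite ltcR.
move: xy; rewrite -ball_normE /= nrmE ltcR => xy.
apply: filterS (y0 _ e20) => i yi.
rewrite -(subrK (y i) (x i)); apply: le_lt_trans (nrmD _ _) _.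
rewrite [e]splitr ltrD//; apply: le_lt_trans xy.
exact: (supnorm_ub (x - y) i).
Qed.

Definition c0sum : cstar_ideal bprod :=
  CStarIdeal c0sum0 c0sumD c0sumZ c0sumMl c0sumMr c0sum_closed.

End BoundedProduct.

Section Properties.
Variable R : realType.
Implicit Types A B : cstarType R.

Definition separable A : Prop := exists2 S : set A, countable S & dense S.

Definition projective A : Prop :=
  forall (B : cstarType R) (I : cstar_ideal B) (phi : A -> cquot I),
    is_starhom phi ->
    exists2 psi : A -> B, is_starhom psi & forall a, cpi I (psi a) = phi a.

Definition semiprojective A : Prop :=
  forall (B : cstarType R) (I : cstar_ideal B) (J : nat -> cstar_ideal B),
    (forall n, J n `<=` J n.+1) ->
    ideal_set I = closure (\bigcup_n J n) ->
    forall phi : A -> cquot I, is_starhom phi ->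
    exists n, exists2 psi : A -> cquot (J n),
      is_starhom psi & forall a, cquot_map I (psi a) = phi a.

Definition finite_dim B : Prop :=
  exists (n : nat) (b : 'I_n -> B),
    forall x, exists c : 'I_n -> R[i], x = \sum_i c i *: b i.

Definition RFD A : Prop :=
  forall x : A, x != 0 ->
    exists (B : cstarType R) (f : A -> B),
      [/\ finite_dim B, is_starhom f & f x != 0].

Record is_cstar_subalgebra B (I : cstar_ideal B) (D : set (cquot I)) : Prop :=
  IsCStarSubalgebra {
  subalg0 : D 0;
  subalgD : forall x y, D x -> D y -> D (x + y);
  subalgZ : forall (k : R[i]) x, D x -> D (k *: x);
  subalgM : forall x y, D x -> D y -> D (x ** y);
  subalg_star : forall x, D x -> D (star x);
  subalg_closed : closed D
}.

Definition MF A : Prop :=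
  exists n : nat -> nat, (forall i, (0 < n i)%N) /\
  exists (D : set (cquot (c0sum (fun i => mxalg R (n i))))) f,
    [/\ is_cstar_subalgebra D, is_starhom (f : A -> cquot _),
        injective f & range f = D].

End Properties.

(* Main.v *)
From HB Require Import structures.
From mathcomp Require Import all_boot all_order all_algebra.
From mathcomp Require Import all_classical all_reals.
From mathcomp Require Import topology normedtype sequences.
From mathcomp Require Import complex ring lra.
Require Import Defs.
Set Implicit Arguments.
Unset Strict Implicit.
Unset Printing Implicit Defensive.
Import Order.TTheory GRing.Theory Num.Theory Normc.
Import numFieldNormedType.Exports.
Local Open Scope classical_set_scope.
Local Open Scope ring_scope.
Local Open Scope complex_scope.

(** In both halves a *-homomorphism out of [A] is lifted to bounded sequences
    of matrices, and the lift is evaluated at one index where it does not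
    vanish at the given [x <> 0].

    If [A] is MF and semiprojective, it embeds in the product of matrix algebras
    modulo the sequences tending to 0. That ideal is the closure of the union of
    the ideals of sequences supported on the first [n] indices
    ([c0sum_closure]), so the embedding lifts to the quotient by one of these.
    There the [i]-th entry makes sense for [n <= i] ([tail_starhom]), and some
    such entry of the lift of [x] is nonzero, since otherwise [x] would be sent
    to 0 by the embedding.

    If [A] is projective, another target is needed, and it comes from a
    representation of [A] on a separable Hilbert space [H] not killing [x].
    Compressing an operator on [H] to the span of the first [n] vectors of an
    orthonormal basis, for every [n], gives a sequence of matrices that
    converges *-strongly, and the compressions of a product differ from the
    product of the compressions by a sequence converging *-strongly to 0. Hence
    the bounded operators on [H] are the quotient of a C*-algebra of sequences
    of matrices ([strong_seqs]) by an ideal ([snull_ideal]), and projectivity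
    lifts the representation to matrices.

    The space [H] never has to be built. A positive functional [w] on [A] gives
    the form [w (star a ** b)]; Gram-Schmidt for this form, applied to a dense
    sequence of [A], gives vectors [e i] in [A] itself, and the compressions are
    the matrices with entries [w (star (e i) ** (a ** e j))]
    ([compression_starhom]). These entries cannot all vanish at [x] when
    [w (star (x ** y) ** (x ** y)) <> 0] for some [y]
    ([compression_class_neq0]); so it suffices to find a positive [w] that does
    not vanish at [star z ** z] for [z = x ** (star x ** x)].

    Such a [w] exists by [hahn_banach], applied to the distance to the cone of
    positive elements: what has to be known is that this cone contains every
    [star y ** y] ([psd_mulstar]) and that adding a positive element cannot
    bring the norm of another positive element close to 0 ([psd_add_nrm]). Both
    are proved without spectral theory. After adjoining a unit [e], positive
    means being the square of a selfadjoint element. By an iterative square root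
    ([sqrt_one_sub]) a selfadjoint [h] is positive as soon as
    [|t e - h| <= t] for one [t > 0], and conversely this holds for all
    [t >= |h|] ([psd_nrm]); in the form of this norm condition, sums are
    harmless. *)

(** * Hahn-Banach theorem *)

Section HahnBanach.
Variables (R : realType) (V : lmodType R[i]).
Implicit Types (p q g : V -> R) (x y z : V).

Definition sublinear q :=
  (forall x y, q (x + y) <= q x + q y) /\
  (forall (r : R) x, 0 < r -> q (r%:C *: x) <= r * q x).

Let scale1C x : 1%:C *: x = x.
Proof. exact: scale1r. Qed.

Let scaleCM (k l : R) x : (k * l)%:C *: x = k%:C *: (l%:C *: x).
Proof. by rewrite scalerA; congr (_ *: _); exact: rmorphM. Qed.

Lemma sublinear0 q : sublinear q -> q 0 = 0.
Proof.
move=> [qD qZ]; apply/eqP; rewrite eq_le; apply/andP; split.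
  by have := qZ 2^-1 0; rewrite scaler0 invr_gt0 ltr0Sn => /(_ isT); lra.
by have := qD 0 0; rewrite addr0; lra.
Qed.

Lemma sublinearZ q (r : R) x : sublinear q -> 0 <= r -> q (r%:C *: x) = r * q x.
Proof.
move=> sq; rewrite le_eqVlt => /predU1P[<-|r0].
  by rewrite scale0r mul0r sublinear0.
have [qD qZ] := sq; apply/eqP; rewrite eq_le qZ//=.
have := qZ r^-1 (r%:C *: x); rewrite -scaleCM mulVf ?lt0r_neq0// scale1C.
by rewrite invr_gt0 mulrC ler_pdivlMr// mulrC => /(_ r0).
Qed.

Lemma sublinearN q x : sublinear q -> - q (- x) <= q x.
Proof.
move=> sq; have := sq.1 x (- x); rewrite subrr sublinear0//; lra.
Qed.

(** Superadditivity makes [q] additive, hence odd, which extends the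
    homogeneity to negative scalars. *)
Lemma sublinear_linear q : sublinear q -> (forall x y, q x + q y <= q (x + y)) ->
  (forall x y, q (x + y) = q x + q y) /\ (forall (r : R) x, q (r%:C *: x) = r * q x).
Proof.
move=> sq qD; have qA x y : q (x + y) = q x + q y.
  by apply/eqP; rewrite eq_le qD sq.1.
split=> // r x; have [r0|r0] := leP 0 r; first exact: sublinearZ.
have := qA (r%:C *: x) ((- r)%:C *: x).
rewrite (sublinearZ _ sq (r := - r)); last by rewrite oppr_ge0 ltW.
rewrite -scalerDl rmorphN subrr scale0r sublinear0//; lra.
Qed.

Lemma le_addinf (A B : set R) (c : R) : A !=set0 -> B !=set0 ->
  (forall a b, A a -> B b -> c <= a + b) -> c <= inf A + inf B.
Proof.
move=> A0 B0 cAB; rewrite -lerBlDr; apply: lb_le_inf => // a Aa.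
rewrite lerBlDr addrC -lerBlDr; apply: lb_le_inf => // b Bb.
by rewrite lerBlDr addrC; exact: cAB.
Qed.

(** The largest sublinear functional below [q] with the value [- q y] at [- y].
    A minimal sublinear functional equals all of its reductions. *)
Definition reduce q y x : R := inf [set q (x + t%:C *: y) - t * q y | t in [set t | 0 <= t]].

Lemma reduce_le q y x (t : R) : sublinear q -> 0 <= t ->
  reduce q y x <= q (x + t%:C *: y) - t * q y.
Proof.
move=> sq t0; apply: ge_inf; last by exists t.
exists (- q (- x)) => _ [s /= s0 <-].
have := sq.1 (- x) (x + s%:C *: y); rewrite addKr sublinearZ//; lra.
Qed.

Lemma reduce_sublinear q y : sublinear q -> sublinear (reduce q y).
Proof.
move=> sq; split=> [x1 x2|r x r0].
  apply: le_addinf; [by eexists; exists 0 => /=|by eexists; exists 0 => /=|].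
  move=> _ _ [t /= t0 <-] [s /= s0 <-].
  apply: le_trans (reduce_le y (x1 + x2) sq (addr_ge0 t0 s0)) _.
  have := sq.1 (x1 + t%:C *: y) (x2 + s%:C *: y).
  rewrite addrACA -scalerDl -rmorphD/=; lra.
rewrite -ler_pdivrMl//; apply: lb_le_inf; first by eexists; exists 0 => /=.
move=> _ [t /= t0 <-]; rewrite ler_pdivrMl// mulrBr.
apply: le_trans (reduce_le y _ sq (mulr_ge0 (ltW r0) t0)) _.
by rewrite scaleCM -scalerDr sublinearZ ?(ltW r0)// mulrA.
Qed.

Lemma reduce_self q y x : sublinear q -> reduce q y x <= q x.
Proof.
by move=> sq; have := reduce_le y x sq (lexx 0); rewrite scale0r addr0 mul0r subr0.
Qed.

(** Zorn's lemma: the pointwise infimum of a chain is again sublinear, and it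
    is finite because every member [q] satisfies [- p (- x) <= q x]. *)
Lemma minimal_sublinear p : sublinear p -> exists q, [/\ sublinear q,
  (forall x, q x <= p x) &
  forall q', sublinear q' -> (forall x, q' x <= q x) -> q' = q].
Proof.
move=> sp; pose T := {q | sublinear q /\ forall x, q x <= p x}.
pose mk q (sq : sublinear q) (qp : forall x, q x <= p x) : T := exist _ q (conj sq qp).
pose le (q1 q2 : T) := `[< forall x, sval q2 x <= sval q1 x >].
have [||||[q [sq qp]] qmin] := @Zorn T le.
- by move=> q; apply/asboolP.
- by move=> q1 q2 q3 /asboolP h12 /asboolP h23; apply/asboolP => x; exact: le_trans (h23 x) (h12 x).
- move=> [q1 h1] [q2 h2] /asboolP /= h12 /asboolP /= h21.
  have E : q1 = q2 by apply/funext => x; apply/eqP; rewrite eq_le h12 h21.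
  by subst q2; congr exist; exact: Prop_irrelevance.
- move=> A tA; have [[q0 Aq0]|A0] := pselect (A !=set0); last first.
    by exists (mk p sp (fun x => lexx _)) => s As; case: A0; exists s.
  pose Q x := [set sval q x | q in A].
  have Q0 x : Q x !=set0 by exists (sval q0 x), q0.
  have lbQ x : has_lbound (Q x).
    exists (- p (- x)) => _ [[q [sq qp]] _ <-] /=.
    by apply: le_trans (sublinearN x sq); rewrite lerN2.
  have Qle (q : T) x : A q -> inf (Q x) <= sval q x by move=> Aq; apply: ge_inf => //; exists q.
  have sQ : sublinear (fun x => inf (Q x)).
    split=> [x y|r x r0].
      apply: le_addinf => // _ _ [q1 A1 <-] [q2 A2 <-].
      have [/asboolP h|/asboolP h] := tA _ _ A1 A2.
        apply: le_trans (Qle _ _ A2) _; apply: le_trans ((svalP q2).1.1 x y) _.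
        by rewrite lerD2r.
      apply: le_trans (Qle _ _ A1) _; apply: le_trans ((svalP q1).1.1 x y) _.
      by rewrite lerD2l.
    rewrite -ler_pdivrMl//; apply: lb_le_inf => // _ [q Aq <-].
    rewrite ler_pdivrMl//; apply: le_trans (Qle _ _ Aq) _.
    exact: (svalP q).1.2.
  have Qp x : inf (Q x) <= p x by apply: le_trans (Qle _ x Aq0) ((svalP q0).2 x).
  by exists (mk _ sQ Qp) => q Aq; apply/asboolP => x /=; exact: Qle.
exists q; split=> // q' sq' q'q.
have q'p x : q' x <= p x by exact: le_trans (q'q x) (qp x).
by apply: (congr1 sval (qmin (mk q' sq' q'p) _)); apply/asboolP.
Qed.

(** A minimal sublinear functional [g] is linear: it equals [reduce g y], and
    the definition of the latter at [t = 1] is superadditivity. Starting from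
    [reduce p z] instead of [p] forces [g (- z) <= - p z]. No partially defined
    functionals occur. *)
Lemma hahn_banach p z : sublinear p -> exists g : V -> R,
  [/\ forall x y, g (x + y) = g x + g y,
      forall (r : R) x, g (r%:C *: x) = r * g x,
      forall x, g x <= p x & g z = p z].
Proof.
move=> sp; have sp' := reduce_sublinear z sp.
have [g [sg gp' gmin]] := minimal_sublinear sp'.
have [|gD gZ] := sublinear_linear sg.
  move=> x y; rewrite -lerBrDr.
  rewrite -{1}(gmin (reduce g y) (reduce_sublinear y sg) (fun x => reduce_self y x sg)).
  by have := reduce_le y x sg ler01; rewrite scale1C mul1r.
have gp x : g x <= p x by apply: le_trans (gp' x) _; exact: reduce_self.
exists g; split=> //; apply/eqP; rewrite eq_le gp/=.
have := le_trans (gp' (- z)) (reduce_le z (- z) sp ler01).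
rewrite scale1C mul1r addNr sublinear0// sub0r.
by rewrite -scaleN1r -(rmorph1 (real_complex R)) -rmorphN gZ mulN1r lerN2.
Qed.

End HahnBanach.

(** * Adjoining a unit *)

Section LimitR.
Variables (R : realType) (V : normedModType R[i]).

Lemma cauchy_nrm (F : set_system V) : ProperFilter F -> cauchy F ->
  forall e : R, 0 < e -> \forall x & y \near F, nrm (x - y) < e.
Proof.
move=> FF /cauchy_ballP Fc e e0.
have : \forall x & y \near F, ball x e%:C y by apply: Fc; rewrite ltcR.
by apply: filterS => -[x y]; rewrite -ball_normE /= nrmE ltcR.
Qed.

Lemma cvg_lipschitz (F : set_system V) (f : V -> R) (c : R) :
  ProperFilter F -> cauchy F ->
  (forall x y, `|f x - f y| <= c * nrm (x - y)) -> exists l : R, f @ F --> l.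
Proof.
move=> FF Fc fle; suff: cvg (f @ F) by move/cvg_ex.
apply: R_complete; apply/cauchy_ballP => e e0.
have c1 : 0 < `|c| + 1 by rewrite ltr_wpDl.
rewrite near_map2; have := cauchy_nrm FF Fc (divr_gt0 e0 c1).
apply: filterS => -[x y] /=; rewrite -!ball_normE /= ltr_pdivlMr// => H.
apply: le_lt_trans H; apply: le_trans (fle x y) _.
rewrite mulrC ler_wpM2l ?nrm_ge0//.
by apply: le_trans (ler_norm _) _; rewrite lerDl.
Qed.

(** The limit is stated with [normc] because the norm of [R[i]] as a module over
    itself lives on the alias [R[i]^o]. *)
Lemma cvg_lipschitzC (F : set_system V) (f : V -> R[i]) (c : R) :
  ProperFilter F -> cauchy F ->
  (forall x y, normc (f x - f y) <= c * nrm (x - y)) ->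
  exists l : R[i], forall e : R, 0 < e -> \forall x \near F, normc (l - f x) < e.
Proof.
move=> FF Fc fle.
have [|a /cvgrPdist_lt Fa] := @cvg_lipschitz F (fun x => complex.Re (f x)) c FF Fc.
  move=> x y; rewrite -(raddfB (@complex.Re R : Rcomplex R -> R)).
  exact: le_trans (absRe_normc _) (fle x y).
have [|b /cvgrPdist_lt Fb] := @cvg_lipschitz F (fun x => complex.Im (f x)) c FF Fc.
  move=> x y; rewrite -(raddfB (@complex.Im R : Rcomplex R -> R)).
  exact: le_trans (absIm_normc _) (fle x y).
exists (a +i* b) => e e0; have e20 : 0 < e / 2 by rewrite divr_gt0.
near=> x; apply: le_lt_trans (normc_le _) _.
rewrite [e]splitr (raddfB (@complex.Re R : Rcomplex R -> R)).
rewrite (raddfB (@complex.Im R : Rcomplex R -> R)) /= ltrD//.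
  by near: x; exact: Fa.
by near: x; exact: Fb.
Unshelve. all: by end_near. Qed.

Lemma cvg_nrm (F : set_system V) (l : V) : Filter F ->
  F --> l <-> forall e : R, 0 < e -> \forall x \near F, nrm (l - x) < e.
Proof.
move=> FF; split=> [/cvgrPdist_lt Fl e e0|Fl].
  have ec : 0 < e%:C by rewrite ltcR.
  by apply: filterS (Fl _ ec) => x; rewrite nrmE ltcR.
apply/cvgrPdist_lt => _ /complex_gt0P[e e0 ->].
by apply: filterS (Fl e e0) => x; rewrite nrmE ltcR.
Qed.

End LimitR.

Lemma cvg_lipschitzV (R : realType) (V : normedModType R[i])
  (W : completeNormedModType R[i]) (F : set_system V) (f : V -> W) (c : R) :
  ProperFilter F -> cauchy F ->
  (forall x y, nrm (f x - f y) <= c * nrm (x - y)) -> exists l : W, f @ F --> l.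
Proof.
move=> FF Fc fle; suff: cvg (f @ F) by move/cvg_ex.
apply: cauchy_cvg; apply/cauchy_ballP => _ /complex_gt0P[e e0 ->].
have c1 : 0 < `|c| + 1 by rewrite ltr_wpDl.
rewrite near_map2; have := cauchy_nrm FF Fc (divr_gt0 e0 c1).
apply: filterS => -[x y] /=; rewrite -!ball_normE /= nrmE ltcR.
rewrite ltr_pdivlMr// => H; apply: le_lt_trans H; apply: le_trans (fle x y) _.
rewrite mulrC ler_wpM2l ?nrm_ge0//.
by apply: le_trans (ler_norm _) _; rewrite lerDl.
Qed.

Lemma normc_conj (R : rcfType) (k : R[i]) : normc (k^*)%C = normc k.
Proof. by case: k => a b /=; rewrite sqrrN. Qed.

(** A pair [(a, k)] stands for [a + k 1]. The construction is used for all [A];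
    when [A] has a unit already, some nonzero [(a, k)] act on [A] as 0 by left
    multiplication, which is why the norm below also takes [k] into account. *)
Definition unitization (R : realType) (A : cstarType R) : Type := (A * R[i])%type.

Section Unitization.
Variables (R : realType) (A : cstarType R).
Local Notation U := (unitization A).
Implicit Types (x y z : U) (a b c : A).

HB.instance Definition _ := GRing.Lmodule.copy U (A * R[i]^o)%type.

Definition uact x b : A := x.1 ** b + x.2 *: b.

Let umul x y : U := (x.1 ** y.1 + x.2 *: y.1 + y.2 *: x.1, x.2 * y.2).
Let ustar x : U := (star x.1, (x.2^*)%C).

Lemma uactZ x (k : R[i]) b : uact x (k *: b) = k *: uact x b.
Proof. by rewrite /uact starmulZr scalerDr !scalerA mulrC. Qed.

Lemma uactDl x y b : uact (x + y) b = uact x b + uact y b.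
Proof. by rewrite /uact starmulDl scalerDl addrACA. Qed.

Lemma uactZl (k : R[i]) x b : uact (k *: x) b = k *: uact x b.
Proof. by rewrite /uact starmulZl scalerDr scalerA. Qed.

Let uact_mul x y b : uact (umul x y) b = uact x (uact y b).
Proof.
rewrite /uact /= !starmulDl !starmulDr !starmulZl !starmulZr scalerDr scalerA.
by rewrite starmulA !addrA; congr (_ + _); rewrite -!addrA; congr (_ + _); rewrite addrC.
Qed.

(** [ustar x] acts as the adjoint of [x] for the [A]-valued inner product
    [star b ** c]; the C*-identity of the operator norm follows from this as
    for operators on a Hilbert space. *)
Let uact_star x b c : star (uact x b) ** c = star b ** uact (ustar x) c.
Proof.
by rewrite /uact starD starM starZ starmulDl starmulDr starmulZl starmulZr starmulA.
Qed.

Let umulA : associative umul.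
Proof.
move=> [a k] [b l] [c m]; rewrite /umul /=; congr (_, _); last by rewrite mulrA.
rewrite !(starmulDl, starmulDr, starmulZl, starmulZr, scalerDr, scalerA, starmulA).
by rewrite [l * m]mulrC [k * m]mulrC !addrA [LHS]+%R.[ACl 1*4*2*5*3*6*7].
Qed.

Let umulDl : left_distributive umul +%R.
Proof.
move=> [a k] [b l] [c m]; congr (_, _); last by rewrite /= mulrDl.
by rewrite /= starmulDl scalerDl scalerDr !addrA [LHS]+%R.[ACl 1*3*5*2*4*6].
Qed.

Let umulDr : right_distributive umul +%R.
Proof.
move=> [a k] [b l] [c m]; congr (_, _); last by rewrite /= mulrDr.
by rewrite /= starmulDr scalerDl scalerDr !addrA [LHS]+%R.[ACl 1*3*5*2*4*6].
Qed.

Let umulZl (k : R[i]) x y : umul (k *: x) y = k *: umul x y.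
Proof.
case: x y => a l [b m]; congr (_, _); last exact/esym/mulrA.
by rewrite /= !scalerDr starmulZl !scalerA [m * k]mulrC.
Qed.

Let umulZr (k : R[i]) x y : umul x (k *: y) = k *: umul x y.
Proof.
case: x y => a l [b m]; congr (_, _); last exact: mulrCA.
by rewrite /= !scalerDr starmulZr !scalerA [l * k]mulrC.
Qed.

Let ustarK : involutive ustar.
Proof. by move=> [a k]; rewrite /ustar /= starK conjcK. Qed.

Let ustarD : {morph ustar : x y / x + y}.
Proof. by move=> [a k] [b l]; congr (_, _); rewrite /= ?starD ?rmorphD. Qed.

Let ustarZ (k : R[i]) x : ustar (k *: x) = (k^*)%C *: ustar x.
Proof. by case: x => a l; congr (_, _); rewrite /= ?starZ //; exact: rmorphM. Qed.

Let ustarM x y : ustar (umul x y) = umul (ustar y) (ustar x).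
Proof.
case: x y => a k [b l]; congr (_, _) => /=; last by rewrite rmorphM mulrC.
by rewrite !starD starM !starZ addrAC.
Qed.

HB.instance Definition _ := isStarAlg.Build R U
  umulA umulDl umulDr umulZl umulZr ustarK ustarD ustarZ ustarM.

(* The norm of the left multiplication operator. *)
Definition uop x : R := sup [set nrm (uact x b) | b in [set b | nrm b <= 1]].

Let uact_bound x b : nrm (uact x b) <= (nrm x.1 + normc x.2) * nrm b.
Proof.
apply: le_trans (nrmD _ _) _; rewrite mulrDl lerD ?nrmM//.
by rewrite nrmZ.
Qed.

Let uop_sup x b : nrm b <= 1 -> nrm (uact x b) <= uop x.
Proof.
move=> b1; apply: ub_le_sup; last by exists b.
exists (nrm x.1 + normc x.2) => _ [c /= c1 <-]; apply: le_trans (uact_bound _ _) _.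
by rewrite ler_piMr// addr_ge0 ?nrm_ge0 ?normc_ge0.
Qed.

Lemma uop_ge0 x : 0 <= uop x.
Proof. by apply: le_trans (nrm_ge0 (uact x 0)) _; rewrite uop_sup// nrm0. Qed.

Lemma uact_le x b : nrm (uact x b) <= uop x * nrm b.
Proof.
have [b0|b0] := eqVneq (nrm b) 0.
  by rewrite b0 mulr0 (nrm0_eq0 b0) /uact scaler0 addr0 -(scale0r 0) starmulZr scale0r nrm0.
have bp : 0 < nrm b by rewrite lt_def b0 nrm_ge0.
have nv : `|(nrm b)^-1| = (nrm b)^-1 by rewrite ger0_norm ?invr_ge0 ?ltW.
have := @uop_sup x (((nrm b)^-1)%:C *: b).
rewrite uactZ !nrmZr nv mulVf// => /(_ (lexx _)).
by rewrite mulrC ler_pdivrMr.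
Qed.

Lemma uop_lub x (c : R) : 0 <= c ->
  (forall b, nrm (uact x b) <= c * nrm b) -> uop x <= c.
Proof.
move=> c0 xc; apply: ge_sup; first by exists (nrm (uact x 0)), 0; rewrite //= nrm0.
by move=> _ [b /= b1 <-]; apply: le_trans (xc b) _; rewrite ler_piMr.
Qed.

Let uopD x y : uop (x + y) <= uop x + uop y.
Proof.
apply: uop_lub => [|b]; first by rewrite addr_ge0 ?uop_ge0.
by rewrite uactDl mulrDl; apply: le_trans (nrmD _ _) _; rewrite lerD ?uact_le.
Qed.

Let uopZ (k : R[i]) x : uop (k *: x) <= normc k * uop x.
Proof.
apply: uop_lub => [|b]; first by rewrite mulr_ge0 ?normc_ge0 ?uop_ge0.
by rewrite uactZl nrmZ -mulrA ler_wpM2l ?normc_ge0 ?uact_le.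
Qed.

Let uopM x y : uop (x ** y) <= uop x * uop y.
Proof.
apply: uop_lub => [|b]; first by rewrite mulr_ge0 ?uop_ge0.
rewrite uact_mul; apply: le_trans (uact_le _ _) _.
by rewrite -mulrA ler_wpM2l ?uop_ge0 ?uact_le.
Qed.

Let uop_cstar x : uop x ^+ 2 <= uop (star x ** x).
Proof.
set c := uop (star x ** x); have c0 : 0 <= c := uop_ge0 _.
rewrite -[c]sqr_sqrtr// ler_pXn2r ?nnegrE ?sqrtr_ge0 ?uop_ge0//.
apply: uop_lub => [|b]; first exact: sqrtr_ge0.
rewrite -(@ler_pXn2r _ 2) ?nnegrE ?mulr_ge0 ?nrm_ge0 ?sqrtr_ge0//.
rewrite exprMn (sqr_sqrtr c0) -nrm_cstar uact_star -uact_mul.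
apply: le_trans (nrmM _ _) _; rewrite nrm_star mulrC expr2 mulrA.
by rewrite ler_wpM2r ?nrm_ge0 ?uact_le.
Qed.

Let fst_le x : nrm x.1 <= uop x + normc x.2.
Proof.
have [->|a0] := eqVneq (nrm x.1) 0.
  by rewrite addr_ge0 ?uop_ge0 ?normc_ge0.
have ap : 0 < nrm x.1 by rewrite lt_def a0 nrm_ge0.
have e : nrm x.1 * nrm x.1 = nrm (x.1 ** star x.1).
  by have := nrm_cstar (star x.1); rewrite starK nrm_star expr2.
rewrite -(ler_pM2r ap) e.
have -> : x.1 ** star x.1 = uact x (star x.1) - x.2 *: star x.1 by rewrite addrK.
apply: le_trans (nrmD _ _) _; rewrite mulrDl lerD//.
  by rewrite -(nrm_star x.1) uact_le.
by rewrite nrmN nrmZ nrm_star.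
Qed.

(** The maximum of two C*-seminorms, the second of which is a norm on [A];
    together they separate points. *)
Definition unorm x : R := Num.max (normc x.2) (uop x).

Let snd_unorm x : normc x.2 <= unorm x.
Proof. by rewrite le_max lexx. Qed.

Let uop_unorm x : uop x <= unorm x.
Proof. by rewrite le_max lexx orbT. Qed.

Let unorm_ge0 x : 0 <= unorm x.
Proof. exact: le_trans (uop_ge0 x) (uop_unorm x). Qed.

Let fst_unorm x : nrm x.1 <= 2 * unorm x.
Proof. by rewrite mulr_natl mulr2n; apply: le_trans (fst_le x) _; rewrite lerD. Qed.

Let unorm_le x : unorm x <= nrm x.1 + normc x.2.
Proof.
rewrite ge_max lerDr nrm_ge0/=; apply: uop_lub => //.
by rewrite addr_ge0 ?nrm_ge0 ?normc_ge0.
Qed.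

Let unormZ_le (k : R[i]) x : unorm (k *: x) <= normc k * unorm x.
Proof.
rewrite ge_max; apply/andP; split.
  by rewrite normcM ler_wpM2l ?normc_ge0.
by apply: le_trans (uopZ _ _) _; rewrite ler_wpM2l ?normc_ge0.
Qed.

Let norm x : R[i] := (unorm x)%:C.

Let normD x y : norm (x + y) <= norm x + norm y.
Proof.
rewrite -rmorphD/= lecR ge_max; apply/andP; split.
  by apply: le_trans (le_normcD _ _) _; rewrite lerD.
by apply: le_trans (uopD _ _) _; rewrite lerD.
Qed.

Let normZ (k : R[i]) x : norm (k *: x) = `|k| * norm x.
Proof.
rewrite normcE_R -rmorphM; congr (_%:C); apply/eqP; rewrite eq_le unormZ_le/=.
have [->|k0] := eqVneq k 0; first by rewrite normc0 mul0r.
have nk : 0 < normc k.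
  by rewrite lt_def normc_ge0 andbT; apply: contra_neq k0 => /eq0_normc.
have := unormZ_le k^-1 (k *: x).
by rewrite scalerA mulVf// scale1r normcV mulrC ler_pdivlMr// mulrC.
Qed.

Let norm0 x : norm x = 0 -> x = 0.
Proof.
move=> /complexI x0; case: x x0 => a k x0; congr (_, _).
  by apply: nrm0_eq0; apply/eqP; rewrite eq_le nrm_ge0 andbT -(mulr0 2) -x0 (fst_unorm (a, k)).
by apply: eq0_normc; apply/eqP; rewrite eq_le normc_ge0 andbT -x0 (snd_unorm (a, k)).
Qed.

HB.instance Definition _ := Lmodule_isNormed.Build R[i] U normD normZ norm0.

Lemma nrm_unitization x : nrm x = unorm x.
Proof. by []. Qed.

Let ucomplete (F : set_system U) : ProperFilter F -> cauchy F -> cvg F.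
Proof.
move=> FF Fc.
have [a Fa] : exists a : A, (fun x : U => x.1) @ F --> a.
  by apply: (cvg_lipschitzV FF Fc (c := 2)) => x y; exact: fst_unorm (x - y).
have [k Fk] := @cvg_lipschitzC _ _ F (fun x => x.2) 1 FF Fc
  (fun x y => le_trans (snd_unorm (x - y)) (eq_ind_r (fun r => _ <= r) (lexx _) (mul1r _))).
apply/cvg_ex; exists (a, k); apply/cvg_nrm => e e0.
have e20 : 0 < e / 2 by rewrite divr_gt0.
near=> x; rewrite nrm_unitization; apply: le_lt_trans (unorm_le _) _.
rewrite [e]splitr ltrD//=; last by near: x; exact: Fk.
by near: x; move/cvg_nrm: Fa; exact.
Unshelve. all: by end_near. Qed.

HB.instance Definition _ := Uniform_isComplete.Build U ucomplete.

Let unormM x y : `|x ** y| <= `|x| * `|y|.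
Proof.
rewrite !nrmE -rmorphM/= lecR !nrm_unitization ge_max; apply/andP; split.
  by rewrite normcM ler_pM ?normc_ge0.
by apply: le_trans (uopM _ _) _; rewrite ler_pM ?uop_ge0.
Qed.

Let unorm_cstar x : `|star x ** x| = `|x| ^+ 2.
Proof.
apply/eqP; rewrite eq_le; apply/andP; split; last first.
  rewrite !nrmE -rmorphXn/= lecR !nrm_unitization {1}/unorm.
  case: (leP (normc x.2) (uop x)) => _.
    exact: le_trans (uop_cstar x) (uop_unorm _).
  apply: le_trans (snd_unorm _).
  by rewrite /= normcM normc_conj expr2.
have le_star : unorm (star x) <= unorm x.
  rewrite ge_max; apply/andP; split; first by rewrite /= normc_conj.
  apply: le_trans (uop_unorm x).
  apply: uop_lub => [|b]; first exact: uop_ge0.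
  have [->|z] := eqVneq (nrm (uact (star x) b)) 0.
    by rewrite mulr_ge0 ?uop_ge0 ?nrm_ge0.
  have zp : 0 < nrm (uact (star x) b) by rewrite lt_def z nrm_ge0.
  rewrite -(ler_pM2r zp) -expr2 -nrm_cstar uact_star.
  rewrite -[ustar (star x)]/(star (star x)) starK.
  apply: le_trans (nrmM _ _) _; rewrite nrm_star [uop x * _]mulrC -mulrA.
  by rewrite ler_wpM2l ?nrm_ge0 ?uact_le.
apply: le_trans (unormM _ _) _; rewrite expr2 !nrmE -!rmorphM/= lecR.
by rewrite ler_wpM2r ?nrm_ge0.
Qed.

HB.instance Definition _ := isCStarAlg.Build R U unormM unorm_cstar.

Definition uinj a : U := (a, 0).
Definition uone : U := (0, 1).

Lemma uinj_starhom : is_starhom uinj.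
Proof.
split=> [k a b|a b|a]; congr (_, _) => /=.
- by rewrite scaler0 addr0.
- by rewrite !scale0r !addr0.
- by rewrite mul0r.
- by apply/eqP; rewrite eq_complex /= oppr0 !eqxx.
Qed.

Lemma nrm_uinj a : nrm (uinj a) = nrm a.
Proof.
have n0 : normc (uinj a).2 = 0 by exact: normc0.
apply/eqP; rewrite eq_le nrm_unitization; apply/andP; split.
  by apply: le_trans (unorm_le _) _; rewrite n0 addr0.
by apply: le_trans (fst_le (uinj a)) _; rewrite n0 addr0 uop_unorm.
Qed.

Lemma uone1 x : uone ** x = x.
Proof.
case: x => a k; congr (_, _) => /=; last by rewrite mul1r.
by rewrite -(scale0r 0) starmulZl !scale0r scaler0 scale1r addr0 add0r.
Qed.

Lemma u1one x : x ** uone = x.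
Proof.
case: x => a k; congr (_, _) => /=; last by rewrite mulr1.
by rewrite -(scale0r 0) starmulZr !scale0r scaler0 scale1r !add0r.
Qed.

Lemma uinj_ideal x a : exists b, x ** uinj a = uinj b.
Proof. by exists (x.1 ** a + x.2 *: a); congr (_, _); rewrite /= ?mulr0 ?scale0r ?addr0. Qed.

End Unitization.

(** * Square roots in a unital C*-algebra *)

(** The increments of [X] are dominated by those of a bounded sequence. *)
Lemma nrm_seq_cvg (R : realType) (V : completeNormedModType R[i])
    (X : nat -> V) (S : nat -> R) (M : R) :
  (forall n, S n <= M) ->
  (forall n m, (n <= m)%N -> nrm (X m - X n) <= S m - S n) ->
  exists x, forall e : R, 0 < e -> exists N, forall n, (N <= n)%N -> nrm (x - X n) < e.
Proof.
move=> SM XS.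
have Sl e : 0 < e -> exists N, forall n m, (N <= n <= m)%N -> S m - S n < e.
  move=> e0; have hs : has_sup (range S).
    by split; [exists (S 0%N), 0%N|exists M => _ [n _ <-]].
  have [_ [N _ <-] hN] := sup_adherent e0 hs.
  exists N => n m /andP[Nn nm].
  have Sm : S m <= sup (range S) by apply: ub_le_sup; [case: hs|exists m].
  have NSn : S N <= S n by rewrite -subr_ge0; apply: le_trans (XS _ _ Nn); exact: nrm_ge0.
  by lra.
have : cvg (X @ \oo).
  apply: cauchy_cvg; apply/cauchy_ballP => e e0; rewrite near_map2.
  have [r r0 ->] := complex_gt0P e0; have [N hN] := Sl r r0.
  exists ([set n | (N <= n)%N], [set n | (N <= n)%N]).
    by split; exists N.
  move=> [n m] /= [Nn Nm]; rewrite -ball_normE /= nrmE ltcR.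
  have [nm|/ltnW mn] := leqP n m.
    by rewrite nrmB; apply: le_lt_trans (XS _ _ nm) (hN _ _ _); rewrite Nn.
  by apply: le_lt_trans (XS _ _ mn) (hN _ _ _); rewrite Nm.
move=> /cvg_ex[x Xx]; exists x => e e0.
have ec : 0 < e%:C by rewrite ltcR.
move/cvgrPdist_lt : Xx => /(_ _ ec)[N _ hN]; exists N => n Nn.
by rewrite -ltcR -nrmE; exact: hN.
Qed.

Lemma nrm_small (R : realType) (V : normedModType R[i]) (z : V) (C : R) :
  (forall e : R, 0 < e -> nrm z <= C * e) -> z = 0.
Proof.
move=> zC; apply: nrm0_eq0; apply/eqP; rewrite eq_le nrm_ge0 andbT.
apply/ler_addgt0Pr => e e0; rewrite add0r.
have c1 : 0 < `|C| + 1 by rewrite ltr_wpDl.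
apply: le_trans (zC (e / (`|C| + 1)) (divr_gt0 e0 c1)) _.
rewrite mulrA ler_pdivrMr//; have := ler_norm C; nra.
Qed.

Section StarAlgebra.
Variables (R : rcfType) (U : starAlgType R).
Implicit Types x y : U.

Lemma starmulN x y : x ** (- y) = - (x ** y).
Proof. by rewrite -scaleN1r starmulZr scaleN1r. Qed.

Lemma starmulNl x y : (- x) ** y = - (x ** y).
Proof. by rewrite -scaleN1r starmulZl scaleN1r. Qed.

Lemma starN x : star (- x) = - star x.
Proof. by rewrite -scaleN1r starZ rmorphN rmorph1 scaleN1r. Qed.

Lemma scaleCD (k l : R) x : k%:C *: x + l%:C *: x = (k + l)%:C *: x.
Proof. by rewrite -scalerDl; congr (_ *: _); exact/esym/rmorphD. Qed.

Lemma scaleCA (k l : R) x : k%:C *: (l%:C *: x) = (k * l)%:C *: x.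
Proof. by rewrite scalerA; congr (_ *: _); exact/esym/rmorphM. Qed.

Lemma scaleC1 x : 1%:C *: x = x.
Proof. exact: scale1r. Qed.

Lemma scaleCN (k : R) x : - (k%:C *: x) = (- k)%:C *: x.
Proof. by rewrite -scaleNr; congr (_ *: _); apply/esym/rmorphN. Qed.

Lemma starmul0 x : x ** 0 = 0.
Proof. by rewrite -(scale0r 0) starmulZr !scale0r. Qed.

Lemma star0mul x : 0 ** x = 0.
Proof. by rewrite -(scale0r 0) starmulZl !scale0r. Qed.

End StarAlgebra.

Section Selfadjoint.
Variables (R : realType) (U : cstarType R).
Implicit Types p q u x : U.

Lemma starmulxx_eq0 x : star x ** x = 0 -> x = 0.
Proof.
move=> x0; apply: nrm0_eq0; apply/eqP; rewrite -sqrf_eq0 -nrm_cstar x0 nrm0.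
by [].
Qed.

(** By commutation [p + i q] is normal with
    [star (p + i q) ** (p + i q) = p ** p + q ** q]; the same holds for
    [p - i q], and [p] is their mean. *)
Lemma nrm_le_add_sq p q : star p = p -> star q = q -> p ** q = q ** p ->
  nrm p ^+ 2 <= nrm (p ** p + q ** q).
Proof.
move=> sp sq pq.
have H (s : R[i]) : s + (s^*)%C = 0 -> s * (s^*)%C = 1 ->
    nrm (p + s *: q) ^+ 2 = nrm (p ** p + q ** q).
  move=> s0 s1; rewrite -nrm_cstar starD starZ sp sq.
  rewrite !(starmulDl, starmulDr, starmulZl, starmulZr) scalerDr scalerA.
  rewrite [(s^*)%C * s]mulrC s1 scale1r pq.
  by rewrite !addrA -[X in X + _]addrA -scalerDl s0 scale0r addr0.
have C1 : nrm (p + 'i%C *: q) ^+ 2 = nrm (p ** p + q ** q) by apply: H; simpc.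
have C2 : nrm (p - 'i%C *: q) ^+ 2 = nrm (p ** p + q ** q).
  by rewrite -scaleNr; apply: H; simpc.
have pE : p + p = (p + 'i%C *: q) + (p - 'i%C *: q).
  by rewrite addrACA subrr addr0.
have p2 : nrm (p + p) = 2 * nrm p.
  by rewrite -mulr2n -scaler_nat -(rmorph_nat (real_complex R)) nrmZr ger0_norm.
have := nrmD (p + 'i%C *: q) (p - 'i%C *: q); rewrite -pE p2.
have -> : nrm (p - 'i%C *: q) = nrm (p + 'i%C *: q).
  by apply/eqP; rewrite -(@eqrXn2 _ 2) ?nrm_ge0// C1 C2.
move=> le2; rewrite -C1 ler_pXn2r ?nnegrE ?nrm_ge0//; lra.
Qed.

End Selfadjoint.

Section Unital.
Variables (R : realType) (U : cstarType R) (e : U).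
Hypotheses (e1 : forall x : U, e ** x = x) (e2 : forall x : U, x ** e = x).
Implicit Types a c h k u v x y : U.
Local Notation comm x y := (x ** y = y ** x).

Lemma star_one : star e = e.
Proof. by rewrite -[RHS]starK -[in RHS](e2 (star e)) starM starK e2. Qed.

Lemma nrm_one_le1 : nrm e <= 1.
Proof.
have : nrm e = nrm e ^+ 2 by rewrite -nrm_cstar star_one e1.
have := nrm_ge0 e; by nra.
Qed.

Lemma commZ (k : R[i]) x y : comm x y -> comm (k *: x) y.
Proof. by move=> xy; rewrite starmulZl starmulZr xy. Qed.

Lemma commD x x' y : comm x y -> comm x' y -> comm (x + x') y.
Proof. by move=> xy xy'; rewrite starmulDl starmulDr xy xy'. Qed.

Lemma commM x x' y : comm x y -> comm x' y -> comm (x ** x') y.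
Proof. by move=> xy xy'; rewrite -starmulA xy' !starmulA xy. Qed.

Lemma starmulACA x x' y y' : comm y x' ->
  (x ** y) ** (x' ** y') = (x ** x') ** (y ** y').
Proof. by move=> yx; rewrite -!starmulA (starmulA y) yx -starmulA. Qed.

(** The fixed points of the iteration are the [x] with [2 x = c + x ** x], that
    is [(1 - x) ** (1 - x) = 1 - c]. *)
Fixpoint sqrt_iter c n : U :=
  if n is m.+1 then (2^-1)%:C *: (c + sqrt_iter c m ** sqrt_iter c m) else 0.

(** The scalar iteration for [c = 1]; it increases to 1. *)
Let S := fix S n : R := if n is m.+1 then 2^-1 * (1 + S m ^+ 2) else 0.

(** All terms of [sqrt_iter c] are polynomials in [c] with nonnegative
    coefficients, so their increments are bounded in norm by those of the scalar
    iteration [S]. This gives convergence also in the boundary case [|c| = 1],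
    and the limit commutes with everything that commutes with [c]. *)
Lemma sqrt_one_sub c : star c = c -> nrm c <= 1 ->
  exists s, [/\ star s = s, s ** s = e - c, nrm (e - s) <= 1 &
    forall y, comm c y -> comm s y].
Proof.
move=> sc c1; pose X := sqrt_iter c; have half0 : 0 <= 2^-1 :> R by rewrite invr_ge0.
have XS n : X n.+1 = (2^-1)%:C *: (c + X n ** X n) by [].
have SS n : S n.+1 = 2^-1 * (1 + S n ^+ 2) by [].
have S01 n : 0 <= S n <= 1.
  by elim: n => [|n IH]; [rewrite /= lexx ler01|rewrite SS; nra].
have Xc n y : comm c y -> comm (X n) y.
  move=> cy; elim: n => [|n IH]; first by rewrite /= starmul0 star0mul.
  by rewrite XS; apply: commZ; apply: commD => //; exact: commM.
have sX n : star (X n) = X n.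
  by elim: n => [|n IH]; rewrite ?XS ?starZr ?starD ?starM ?IH ?sc// star0.
have nX n : nrm (X n) <= S n.
  elim: n => [|n IH]; first by rewrite nrm0.
  rewrite XS SS nrmZr ger0_norm// ler_wpM2l//.
  apply: le_trans (nrmD _ _) _; rewrite lerD//.
  by apply: le_trans (nrmM _ _) _; rewrite expr2 ler_pM ?nrm_ge0.
have XX n m : comm (X n) (X m) by apply: (Xc n); apply/esym/(Xc m).
have dX n : nrm (X n.+1 - X n) <= S n.+1 - S n.
  elim: n => [|n IH].
    rewrite XS SS /= subr0 starmul0 addr0 subr0 expr0n addr0 mulr1.
    by rewrite nrmZr ger0_norm// ler_piMr.
  rewrite XS [X in _ - X]XS [S n.+2]SS.
  have -> : (2^-1)%:C *: (c + X n.+1 ** X n.+1) - (2^-1)%:C *: (c + X n ** X n) =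
      (2^-1)%:C *: ((X n.+1 - X n) ** (X n.+1 + X n)).
    rewrite -scalerBr; congr (_ *: _).
    rewrite opprD addrACA subrr add0r starmulBl !starmulDr (XX n n.+1).
    by rewrite opprD addrA addrK.
  rewrite nrmZr ger0_norm//.
  have := nrmM (X n.+1 - X n) (X n.+1 + X n).
  have := nrmD (X n.+1) (X n); have := nX n; have := nX n.+1.
  have := nrm_ge0 (X n.+1 - X n); have := nrm_ge0 (X n.+1 + X n).
  have := S01 n; have := S01 n.+1; move: IH (SS n).
  move: (nrm (_ ** _)) (nrm (_ - _)) (nrm (_ + _)) (nrm (X n.+1)) (nrm (X n)).
  move: (S n) (S n.+1) => s s' r1 r2 r3 r4 r5 IH Ss hs hs' h1 h2 h3 h4 h5 h6.
  have h7 : r3 <= s' + s by lra.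
  have : r2 * r3 <= (s' - s) * (s' + s) by rewrite ler_pM.
  by nra.
have dXm n m : (n <= m)%N -> nrm (X m - X n) <= S m - S n.
  elim: m => [|m IH]; first by rewrite leqn0 => /eqP ->; rewrite !subrr nrm0.
  rewrite leq_eqVlt => /predU1P[->|]; first by rewrite !subrr nrm0.
  move=> /IH {}IH; have -> : X m.+1 - X n = (X m.+1 - X m) + (X m - X n).
    by rewrite addrA subrK.
  by apply: le_trans (nrmD _ _) _; have := dX m; lra.
have [|x Xx] := @nrm_seq_cvg R U X S 1 _ dXm; first by move=> n; case/andP: (S01 n).
have nx1 : nrm x <= 1.
  apply/ler_addgt0Pr => d d0; have [N /(_ N (leqnn N)) hN] := Xx d d0.
  have := nrmD (x - X N) (X N); rewrite subrK; have := nX N; have := S01 N.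
  by lra.
have eqx : x = (2^-1)%:C *: (c + x ** x).
  apply/eqP; rewrite -subr_eq0; apply/eqP; apply: (nrm_small (C := 2)) => d d0.
  have [N hN] := Xx d d0; have h1 := hN N (leqnn N); have h2 := hN N.+1 (leqnSn N).
  have -> : x - (2^-1)%:C *: (c + x ** x) = (x - X N.+1) -
      (2^-1)%:C *: ((x - X N) ** x + X N ** (x - X N)).
    rewrite starmulBl starmulBr addrA subrK XS -[RHS]addrA -opprD -scalerDr.
    by rewrite -(addrA c) [X N ** X N + _]addrC subrK.
  apply: le_trans (nrmD _ _) _; rewrite nrmN nrmZr ger0_norm//.
  have := nrmD ((x - X N) ** x) (X N ** (x - X N)).
  have := nrmM (x - X N) x; have := nrmM (X N) (x - X N).
  have := nX N; have := S01 N; have := nrm_ge0 (x - X N).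
  have := nrm_ge0 (X N); have := nrm_ge0 x; move: h1 h2 nx1.
  move: (nrm (x - _)) (nrm (x - X N)) (nrm (_ + _)) (nrm (X N)) (nrm x).
  move: (nrm (_ ** x)) (nrm (X N ** _)) => *.
  by nra.
have xc y : comm c y -> comm x y.
  move=> cy; apply/eqP; rewrite -subr_eq0; apply/eqP.
  apply: (nrm_small (C := 2 * nrm y)) => d d0.
  have [N /(_ N (leqnn N)) hN] := Xx d d0.
  have -> : x ** y - y ** x = (x - X N) ** y - y ** (x - X N).
    by rewrite starmulBl starmulBr (Xc N y cy) opprB addrA subrK.
  apply: le_trans (nrmD _ _) _; rewrite nrmN.
  have := nrmM (x - X N) y; have := nrmM y (x - X N); have := nrm_ge0 y.
  by nra.
have sx : star x = x.
  apply/eqP; rewrite -subr_eq0; apply/eqP; apply: (nrm_small (C := 2)) => d d0.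
  have [N /(_ N (leqnn N)) hN] := Xx d d0.
  have -> : star x - x = star (x - X N) - (x - X N).
    by rewrite starB sX opprB addrA subrK.
  by apply: le_trans (nrmD _ _) _; rewrite nrmN nrm_star; lra.
exists (e - x); split.
- by rewrite starB star_one sx.
- have xx : x + x = c + x ** x.
    rewrite -{1 2}(scaleC1 x) scaleCD {1}eqx scaleCA.
    by rewrite (_ : (1 + 1) * 2^-1 = 1) ?scaleC1//; lra.
  rewrite starmulBl !starmulBr e1 e2 e1 opprB -addrA; congr (_ + _).
  by rewrite addrCA -opprD xx opprD addrCA subrr addr0.
- by rewrite subKr.
- by move=> y /xc xy; rewrite starmulBl starmulBr e1 e2 xy.
Qed.

End Unital.

(** * Positive elements *)

Section Positive.
Variables (R : realType) (U : cstarType R) (e : U).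
Hypotheses (e1 : forall x : U, e ** x = x) (e2 : forall x : U, x ** e = x).
Implicit Types a c h k u v x y : U.
Local Notation comm x y := (x ** y = y ** x).

Let half_ge0 : 0 <= 2^-1 :> R.
Proof. by rewrite invr_ge0. Qed.

(** Positivity as the existence of a selfadjoint square root; agreement with
    [star y ** y] is the content of [psd_mulstar]. *)
Definition psd h := exists2 u, star u = u & h = u ** u.

Lemma psd_star h : psd h -> star h = h.
Proof. by move=> [u su ->]; rewrite starM su. Qed.

Lemma psd0 : psd 0.
Proof. by exists 0; rewrite ?star0 ?starmul0. Qed.

Lemma psdZ (t : R) h : 0 <= t -> psd h -> psd (t%:C *: h).
Proof.
move=> t0 [u su ->]; exists ((Num.sqrt t)%:C *: u); first by rewrite starZr su.
by rewrite starmulZl starmulZr scaleCA -expr2 sqr_sqrtr.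
Qed.

Lemma nrm_sq u : star u = u -> nrm (u ** u) = nrm u ^+ 2.
Proof. by move=> su; rewrite -{1}su nrm_cstar. Qed.

(** With [p = 1 - u^2] and [q = u sqrt(2 - u^2)] one has [p^2 + q^2 = 1], so
    [nrm_le_add_sq] applies. The square root exists since [|u^2 / 2| < 1]. *)
Lemma nrm_one_sub_sq u : star u = u -> nrm u <= 1 -> nrm (e - u ** u) <= 1.
Proof.
move=> su u1; set a := u ** u.
have sa : star a = a by rewrite /a starM su.
have na : nrm a <= 1 by rewrite /a nrm_sq// expr_le1// nrm_ge0.
have [||s [ss s2 _ sC]] := @sqrt_one_sub _ _ _ e1 e2 ((2^-1)%:C *: a).
- by rewrite starZr sa.
- by rewrite nrmZr ger0_norm//; have := nrm_ge0 a; lra.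
have ua : comm u a by rewrite /a starmulA.
have su' : comm s u by apply: sC; apply: commZ.
have sa' : comm s a by apply: sC; apply: commZ.
pose p := e - a; pose q := (Num.sqrt 2 : R)%:C *: (u ** s).
have sp : star p = p by rewrite /p starB (star_one e2) sa.
have sq : star q = q by rewrite /q starZr starM su ss su'.
have pq : comm p q.
  apply/esym/commZ/esym.
  rewrite /p starmulBl starmulBr e1 e2; congr (_ - _).
  by apply: esym; apply: commM; [exact: ua|exact: sa'].
have qq : q ** q = 2%:C *: a - a ** a.
  rewrite /q starmulZl starmulZr scaleCA -expr2 sqr_sqrtr// starmulACA//.
  rewrite -/a s2 starmulBr e2 scalerBr starmulZr scaleCA.
  by rewrite divff ?pnatr_eq0// scaleC1.
have pp : p ** p = e - 2%:C *: a + a ** a.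
  rewrite /p starmulBl !starmulBr !e1 e2 opprB.
  rewrite (_ : 2%:C *: a = a + a); last by rewrite -[in RHS](scaleC1 a) scaleCD.
  by rewrite opprD !addrA addrAC.
have := nrm_le_add_sq sp sq pq; rewrite pp qq addrACA subrr addr0 subrK -/p.
by have := nrm_one_le1 e1 e2; have := nrm_ge0 p; nra.
Qed.

Lemma psd_nrm t h : psd h -> nrm h <= t -> nrm (t%:C *: e - h) <= t.
Proof.
move=> [u su ->]; rewrite nrm_sq// => ut.
have t0 : 0 <= t by apply: le_trans ut; exact: sqr_ge0.
have [tz|tn0] := eqVneq t 0.
  have u0 : nrm u = 0.
    by apply/eqP; rewrite -sqrf_eq0 eq_le sqr_ge0 andbT -tz.
  by rewrite (nrm0_eq0 u0) starmul0 subr0 tz scale0r nrm0.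
pose s := Num.sqrt t; have s0 : 0 < s by rewrite sqrtr_gt0 lt_def tn0.
have ss : s * s = t by rewrite -expr2 sqr_sqrtr.
have [v vE] : {v | v = (s^-1)%:C *: u} by eexists.
have uv : u = s%:C *: v by rewrite vE scaleCA divff ?lt0r_neq0// scaleC1.
have sv : star v = v by rewrite vE starZr su.
have nv : nrm v <= 1.
  rewrite vE nrmZr ger0_norm; last by rewrite invr_ge0 ltW.
  rewrite mulrC ler_pdivrMr// mul1r.
  by rewrite -(@ler_pXn2r _ 2) ?nnegrE ?nrm_ge0 ?(ltW s0)// (expr2 s) ss.
have -> : t%:C *: e - u ** u = t%:C *: (e - v ** v).
  by rewrite scalerBr uv starmulZl starmulZr scaleCA ss.
rewrite nrmZr ger0_norm//; have := nrm_one_sub_sq sv nv; nra.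
Qed.

(** The commutation clause is what replaces the functional calculus, and the
    last clause allows the lemma to be applied again to the root. *)
Lemma psd_root t h : star h = h -> 0 < t -> nrm (t%:C *: e - h) <= t ->
  exists u, [/\ star u = u, u ** u = h, (forall y, comm h y -> comm u y) &
    exists2 s : R, 0 < s & nrm (s%:C *: e - u) <= s].
Proof.
move=> sh t0 ht; pose r := Num.sqrt t; have r0 : 0 < r by rewrite sqrtr_gt0.
have rr : r * r = t by rewrite -expr2 sqr_sqrtr// ltW.
have tV : t * t^-1 = 1 by rewrite divff// lt0r_neq0.
have tV0 : 0 <= t^-1 by rewrite invr_ge0 ltW.
have [||s [ss s2 es sC]] := @sqrt_one_sub _ _ _ e1 e2 (e - (t^-1)%:C *: h).
- by rewrite starB (star_one e2) starZr sh.
- rewrite (_ : _ - _ = (t^-1)%:C *: (t%:C *: e - h)); last first.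
    by rewrite scalerBr scaleCA mulrC tV scaleC1.
  by rewrite nrmZr (ger0_norm tV0) mulrC ler_pdivrMr// mul1r.
exists (r%:C *: s); split.
- by rewrite starZr ss.
- rewrite starmulZl starmulZr scaleCA rr s2 subKr scaleCA.
  by rewrite tV scaleC1.
- move=> y hy; apply/commZ/sC; rewrite starmulBl starmulBr e1 e2; congr (_ - _).
  exact: commZ.
- by exists r => //; rewrite -scalerBr nrmZr gtr0_norm// ler_piMr// ltW.
Qed.

Lemma nrm_psd t h : star h = h -> 0 < t -> nrm (t%:C *: e - h) <= t -> psd h.
Proof. by move=> sh t0 ht; have [u [su <- _ _]] := psd_root sh t0 ht; exists u. Qed.

(** For the norm condition this is the triangle inequality at the sum of two
    admissible values of [t]; the 1 makes that sum positive. *)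
Lemma psdD h k : psd h -> psd k -> psd (h + k).
Proof.
move=> ph pk; have nh := psd_nrm ph (lexx _); have nk := psd_nrm pk (lexx _).
have t0 : 0 < nrm h + 1 + nrm k.
  by rewrite ltr_wpDr ?nrm_ge0// ltr_wpDl ?nrm_ge0.
apply: (nrm_psd _ t0); first by rewrite starD !psd_star.
have nh1 : nrm ((nrm h + 1)%:C *: e - h) <= nrm h + 1.
  by apply: psd_nrm => //; rewrite lerDl.
rewrite -scaleCD opprD addrACA.
by apply: le_trans (nrmD _ _) _; rewrite lerD.
Qed.

Lemma diff_sq (s : R) x :
  (s%:C *: e + x) ** (s%:C *: e + x) - (s%:C *: e - x) ** (s%:C *: e - x) =
  (4 * s)%:C *: x.
Proof.
rewrite starmulBl !starmulBr !starmulDl !starmulDr.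
rewrite !(starmulZl, starmulZr) !e1 !e2.
set a := s%:C *: (_ *: e); set b := s%:C *: x; set c := x ** x.
have -> : (4 * s)%:C *: x = b + b + (b + b).
  by rewrite /b !scaleCD; congr (_%:C *: _); ring.
rewrite opprB opprB !addrA [LHS]+%R.[ACl 2*3*5*7*(1*8)*(4*6)].
by rewrite !subrr !addr0.
Qed.

(** With [t = |h|] both [t + h] and [t - h] have norm at most [t], whereas the
    difference of their squares is [4 t h], of norm [4 t^2]. *)
Lemma psd_anti h : psd h -> psd (- h) -> h = 0.
Proof.
move=> ph pnh; apply: nrm0_eq0; set t := nrm h.
have h1 : nrm (t%:C *: e - h) <= t by apply: psd_nrm.
have h2 : nrm (t%:C *: e + h) <= t.
  by rewrite -[X in _ + X]opprK; apply: psd_nrm; rewrite ?nrmN.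
have := diff_sq t h; move: h1 h2.
set P := _ + h; set M := _ - h => h1 h2 PM.
have := nrmD (P ** P) (- (M ** M)); rewrite PM nrmN nrmZr -/t.
have := nrmM P P; have := nrmM M M; have t0 : 0 <= t := nrm_ge0 _.
rewrite ger0_norm ?mulr_ge0//; move: h1 h2 (nrm_ge0 P) (nrm_ge0 M).
move: (nrm (P ** P)) (nrm (M ** M)) (nrm P) (nrm M) => r1 r2 r3 r4 *.
have tt : t * t <= 0 by nra.
by apply/eqP; rewrite -sqrf_eq0 eq_le sqr_ge0 andbT expr2.
Qed.

(** With [c = |h + k|], both [h] and [c - h = (c - (h + k)) + k] are positive.
    For [g = h - c / 2] and [s = |g|] the norm condition at
    [t = c / 2 + s] bounds [s + g] and [s - g] by [c / 2 + s], and the difference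
    of their squares is [4 s g]; hence [4 s^2 <= 2 (c / 2 + s)^2], which
    excludes [s > 3 c / 2]. The sharp constant is 1. *)
Lemma psd_add_nrm h k : psd h -> psd k -> nrm h <= 2 * nrm (h + k).
Proof.
move=> ph pk; set c := nrm (h + k); have c0 : 0 <= c := nrm_ge0 _.
have [cz|cn0] := eqVneq c 0.
  have hk : h + k = 0 by apply: nrm0_eq0.
  have -> : h = 0; last by rewrite nrm0 mulr_ge0.
  apply: psd_anti => //.
  by rewrite (addr0_eq hk).
have cp : 0 < c by rewrite lt_def cn0.
have pch : psd (c%:C *: e - h).
  have -> : c%:C *: e - h = (c%:C *: e - (h + k)) + k by rewrite opprD addrA subrK.
  apply: psdD => //; apply: (nrm_psd (t := c)) => //; last by rewrite subKr.
  by rewrite starB starZr (star_one e2) starD !psd_star.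
pose d := c / 2; pose g := h - d%:C *: e; pose s := nrm g.
have s0 : 0 <= s := nrm_ge0 _.
have ne := nrm_one_le1 e1 e2.
have nd : nrm (d%:C *: e) <= d.
  by rewrite nrmZr ger0_norm ?divr_ge0// ler_piMr ?divr_ge0.
have hg : h = g + d%:C *: e by rewrite subrK.
have nh : nrm h <= d + s by rewrite hg; apply: le_trans (nrmD _ _) _; rewrite -/s; lra.
have h1 : nrm (s%:C *: e - g) <= d + s.
  have -> : s%:C *: e - g = (d + s)%:C *: e - h.
    by rewrite opprB addrA scaleCD [s + d]addrC.
  exact: psd_nrm.
have h2 : nrm (s%:C *: e + g) <= d + s.
  have -> : s%:C *: e + g = (d + s)%:C *: e - (c%:C *: e - h).
    rewrite opprB /g addrCA [RHS]addrCA !scaleCN !scaleCD.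
    by congr (_ + _%:C *: _); rewrite /d; lra.
  apply: psd_nrm => //.
  have -> : c%:C *: e - h = d%:C *: e - g.
    by rewrite opprB addrA scaleCD; congr (_%:C *: _ - _); rewrite /d; lra.
  by apply: le_trans (nrmD _ _) _; rewrite nrmN -/s; lra.
have := diff_sq s g; move: h1 h2.
set P := _ + g; set M := _ - g => h1 h2 PM.
have := nrmD (P ** P) (- (M ** M)); rewrite PM nrmN nrmZr -/s.
have := nrmM P P; have := nrmM M M.
rewrite ger0_norm ?mulr_ge0//; move: h1 h2 (nrm_ge0 P) (nrm_ge0 M).
move: (nrm (P ** P)) (nrm (M ** M)) (nrm P) (nrm M) => r1 r2 r3 r4 h1 h2 h3 h4 h5 h6 h7.
have ss : 4 * s * s <= 2 * (d + s) ^+ 2 by nra.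
have dE : c = 2 * d by rewrite /d; lra.
apply: le_trans nh _; rewrite dE; have d0 : 0 <= d by lra.
have [//|sd] := leP s (3 * d); first by lra.
by nra.
Qed.

(** Let [a = star y ** y], let [b = sqrt(a^2)] be its absolute value and
    [n = (b - a) / 2] its negative part, so that [a n = - n^2] and [b n = n^2],
    and put [r = y sqrt(b) n]. Then [star r ** r = - n^4] and
    [r ** star r = - (y n star y)^2] are both negative, while their sum is
    positive, being twice the sum of the squares of the real and imaginary parts
    of [r]. So [r = 0], hence [n = 0] and [a = b]. *)
Lemma psd_mulstar y : psd (star y ** y).
Proof.
set a := star y ** y; have sa : star a = a by rewrite /a starM starK.
have paa : psd (a ** a) by exists a.
have t0 : 0 < nrm (a ** a) + 1 by rewrite ltr_wpDl ?nrm_ge0.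
have [|b [sb bb bC [t tp nb]]] := psd_root (psd_star paa) t0.
  by apply: psd_nrm => //; rewrite lerDl.
have ba : comm b a by apply: bC; rewrite starmulA.
(* [d] is the square root of the absolute value [b]. *)
have [d [sd dd dC _]] := psd_root sb tp nb.
have da : comm d a by apply: dC.
have [m mE] : {m | m = b - a} by eexists.
have sm : star m = m by rewrite mE starB sb sa.
have dm : comm d m by rewrite mE starmulBr starmulBl da -dd starmulA.
have am : a ** m = - (b ** m) by rewrite mE !starmulBr bb ba opprB.
have mm : m ** m = 2%:C *: (b ** m).
  rewrite {1}mE starmulBl am opprK.
  by rewrite -{1 2}(scaleC1 (b ** m)) scaleCD.
(* [m] is twice the negative part; [n] is the negative part itself. *)
have [n nE] : {n | n = (2^-1)%:C *: m} by eexists.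
have sn : star n = n by rewrite nE starZr sm.
have dn : comm d n by apply/esym; rewrite nE; apply: commZ; rewrite dm.
have nn : b ** n = n ** n.
  rewrite nE starmulZr starmulZl starmulZr mm !scaleCA.
  by congr (_%:C *: _); lra.
have an : a ** n = - (n ** n) by rewrite -nn nE !starmulZr am scalerN.
pose r := y ** (d ** n).
have srr : star r ** r = - ((n ** n) ** (n ** n)).
  rewrite /r !starM sn sd -!starmulA (starmulA (star y)) -/a.
  rewrite (starmulA a d) -da -(starmulA d a) an !(starmulN, starmulNl).
  by rewrite (starmulA d d) dd (starmulA b) nn -!starmulA.
have rrs : r ** star r = - ((y ** n ** star y) ** (y ** n ** star y)).
  rewrite /r !starM sn sd -!starmulA (starmulA (star y)) -/a (starmulA a n) an.
  rewrite !(starmulN, starmulNl) opprK; congr (_ ** _).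
  have nd z : n ** (d ** z) = d ** (n ** z) by rewrite !starmulA dn.
  by rewrite !nd (starmulA d d) dd (starmulA b n) nn -!starmulA.
have snn : star (n ** n) = n ** n by rewrite starM sn.
have p1 : psd (- (star r ** r)) by rewrite srr opprK; exists (n ** n).
have p2 : psd (- (r ** star r)).
  rewrite rrs opprK; exists (y ** n ** star y) => //.
  by rewrite !starM starK sn starmulA.
pose s := star r.
(* The squares of twice the real part of [r] and, up to sign, of twice its
   imaginary part. *)
have sum4 : psd (star r ** r + r ** star r).
  have -> : star r ** r + r ** star r = (2^-1)%:C *: ((r + s) ** (r + s) +
      ('i%C *: (r - s)) ** ('i%C *: (r - s))).
    rewrite starmulZl starmulZr scalerA -expr2 sqr_i scaleN1r.
    rewrite !(starmulDl, starmulDr) !(starmulN, starmulNl) !(opprD, opprK) -/s.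
    rewrite !addrA [X in _ *: X]+%R.[ACl (1*5)*(4*8)*((3*2)*(7*6))].
    rewrite /= !subrr !add0r -{2 3}(scaleC1 (s ** r + r ** s)) scaleCD scaleCA.
    by rewrite mulVf ?pnatr_eq0// scaleC1.
  apply: psdZ => //; apply: psdD.
    by exists (r + s) => //; rewrite starD /s starK addrC.
  exists ('i%C *: (r - s)) => //.
  rewrite starZ starB /s starK -[in RHS](opprB (star r) r) scalerN -scaleNr.
  by congr (_ *: _); simpc.
have sum0 : star r ** r + r ** star r = 0.
  by apply: psd_anti => //; rewrite opprD; apply: psdD.
have rr0 : star r ** r = 0.
  by apply: psd_anti => //; rewrite -[star r ** r]opprK (addr0_eq sum0).
have n4 : star (n ** n) ** (n ** n) = 0.
  by rewrite snn -[LHS]opprK -srr rr0 oppr0.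
have n2 : star n ** n = 0 by rewrite sn; exact: starmulxx_eq0 n4.
have m0 : m = 0.
  have := starmulxx_eq0 n2; rewrite nE => /eqP; rewrite scaler_eq0.
  by case/orP => /eqP// /complexI/eqP; rewrite invr_eq0 pnatr_eq0.
by exists d => //; rewrite dd; apply/eqP; rewrite eq_sym -subr_eq0 -mE m0.
Qed.

End Positive.

(** * Positive functionals *)

Section State.
Variables (R : realType) (A : cstarType R).
Implicit Types a b h k x y z : A.

Let e1 := @uone1 R A.
Let e2 := @u1one R A.

Definition positive h := psd (uinj h).

Let uinjD x y : uinj (x + y) = uinj x + uinj y.
Proof. by have := starhom_linear (uinj_starhom A) 1 x y; rewrite !scale1r. Qed.

Let uinjZ (k : R[i]) x : uinj (k *: x) = k *: uinj x.
Proof. by congr (_, _); exact/esym/mulr0. Qed.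

Let uinjM := starhom_mul (uinj_starhom A).
Let uinjS := starhom_star (uinj_starhom A).

Lemma positive0 : positive 0.
Proof. by rewrite /positive -(scale0r 0) uinjZ scale0r; exact: psd0. Qed.

Lemma positiveD h k : positive h -> positive k -> positive (h + k).
Proof. by rewrite /positive uinjD; exact: psdD e1 e2 _ _. Qed.

Lemma positiveZ (t : R) h : 0 <= t -> positive h -> positive (t%:C *: h).
Proof. by rewrite /positive uinjZ; exact: psdZ. Qed.

Lemma positive_mulstar x : positive (star x ** x).
Proof. by rewrite /positive uinjM uinjS; exact: psd_mulstar e1 e2 _. Qed.

Lemma positive_add_nrm h k : positive h -> positive k -> nrm h <= 2 * nrm (h + k).
Proof. by rewrite -(nrm_uinj h) -(nrm_uinj (h + k)) uinjD; exact: psd_add_nrm e1 e2 _ _. Qed.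

(** With a square root [u] of the positive element [|x|^2 - star x ** x] of the
    unitization, [b = u y], which lies in the ideal [A]. *)
Lemma positive_nrm_sub x y : exists b,
  (nrm x ^+ 2)%:C *: (star y ** y) = star (x ** y) ** (x ** y) + star b ** b.
Proof.
pose h := star (uinj x) ** uinj x; pose t := nrm x ^+ 2.
have nh : nrm h = t by rewrite /h nrm_cstar nrm_uinj.
have [u su uE] : psd (t%:C *: uone A - h).
  have [t0|t0] := eqVneq t 0.
    by rewrite t0 scale0r (nrm0_eq0 (etrans nh t0)) subrr; exact: psd0.
  have tp : 0 < t by rewrite lt_def t0 sqr_ge0.
  apply: (nrm_psd e1 e2 (t := t)) => //; last by rewrite subKr nh.
  by rewrite starB starZr (star_one e2) /h starM starK.
have [b bE] := uinj_ideal u y.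
exists b; suff: uinj ((nrm x ^+ 2)%:C *: (star y ** y)) =
    uinj (star (x ** y) ** (x ** y) + star b ** b) by case.
rewrite uinjZ uinjD !uinjM !uinjS uinjM -bE !starM su.
rewrite -!starmulA (starmulA u u) -uE starmulBl starmulZl e1 starmulBr starmulZr.
by rewrite /h -!starmulA addrC subrK.
Qed.

Definition dist_positive a : R := inf [set nrm (a + k) | k in positive].

Let dist0 a : [set nrm (a + k) | k in positive] !=set0.
Proof. by eexists; exists 0; first exact: positive0. Qed.

Let dist_le a k : positive k -> dist_positive a <= nrm (a + k).
Proof.
move=> pk; apply: ge_inf; last by exists k.
by exists 0 => _ [l _ <-]; exact: nrm_ge0.
Qed.

Lemma dist_positive_sublinear : sublinear dist_positive.
Proof.
split=> [a b|r a r0].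
  apply: le_addinf => // _ _ [k pk <-] [l pl <-].
  apply: le_trans (dist_le _ (positiveD pk pl)) _.
  by rewrite addrACA nrmD.
rewrite -ler_pdivrMl//; apply: lb_le_inf => // _ [k pk <-].
rewrite ler_pdivrMl//; apply: le_trans (dist_le _ (positiveZ (ltW r0) pk)) _.
by rewrite -scalerDr nrmZr gtr0_norm.
Qed.

(** The constant 2 in the last clause comes from treating real and imaginary
    parts separately. *)
Record positive_functional (w : A -> R[i]) : Prop := PositiveFunctional {
  posfunD : forall x y, w (x + y) = w x + w y;
  posfunZ : forall (k : R[i]) x, w (k *: x) = k * w x;
  posfun_star : forall x, w (star x) = ((w x)^*)%C;
  posfun_ge0 : forall x, 0 <= w (star x ** x);
  posfun_le : forall x, normc (w x) <= 2 * nrm x }.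

(** The distance to the cone of positive elements is 0 at [- h] for [h]
    positive, so a real functional [g] below it is nonnegative on the cone. At
    [star z ** z] it is at least half the norm, by [positive_add_nrm]; so if [g]
    attains the distance there, [g (star z ** z) > 0]. The functional [w] is
    the complexification of the symmetrization [f] of [g]. *)
Lemma exists_positive_functional z : z != 0 ->
  exists2 w, positive_functional w & w (star z ** z) != 0.
Proof.
move=> z0; have [g [gD gZ gp gz]] := hahn_banach (star z ** z) dist_positive_sublinear.
have gN x : g (- x) = - g x.
  by rewrite -scaleN1r -(rmorph1 (real_complex R)) -rmorphN gZ mulN1r.
have gpos h : positive h -> 0 <= g h.
  move=> ph; rewrite -oppr_le0 -gN; apply: le_trans (gp _) _.
  by apply: le_trans (dist_le _ ph) _; rewrite addNr nrm0.
have gle x : `|g x| <= nrm x.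
  have le y : g y <= nrm y.
    by apply: le_trans (gp _) _; rewrite -[y in nrm y]addr0; apply/dist_le/positive0.
  by rewrite ler_norml le andbT lerNl -gN -(nrmN x) le.
pose f x := 2^-1 * (g x + g (star x)).
have fD x y : f (x + y) = f x + f y by rewrite /f starD !gD; ring.
have fZ (r : R) x : f (r%:C *: x) = r * f x by rewrite /f starZr !gZ; ring.
have fN x : f (- x) = - f x by rewrite /f starN !gN; ring.
have fS x : f (star x) = f x by rewrite /f starK addrC.
have fle x : `|f x| <= nrm x.
  rewrite /f normrM ger0_norm ?invr_ge0//.
  have := ler_normD (g x) (g (star x)); have := gle x; have := gle (star x).
  by rewrite nrm_star; lra.
pose w x : R[i] := f x +i* (- f ('i%C *: x)).
have wS x : star x = x -> w x = (g x)%:C.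
  move=> sx; apply/eqP; rewrite eq_complex /=; apply/andP; split; apply/eqP.
    by rewrite /f sx; lra.
  have : f ('i%C *: x) = - f ('i%C *: x); last by lra.
  by rewrite -[LHS]fS starZ sx -fN -scaleNr; congr (f (_ *: _)); simpc.
have sxx x : star (star x ** x) = star x ** x by rewrite starM starK.
exists w; last first.
  rewrite wS//; apply/eqP => /complexI; rewrite gz.
  have pz : 2^-1 * nrm (star z ** z) <= dist_positive (star z ** z).
    apply: lb_le_inf => // _ [k pk <-].
    by have := positive_add_nrm (positive_mulstar z) pk; lra.
  have : 0 < nrm (star z ** z).
    rewrite nrm_cstar exprn_gt0// lt_def nrm_ge0 andbT.
    by apply: contra_neq z0; exact: nrm0_eq0.
  by lra.
split.
- move=> x y; rewrite /w scalerDr !fD opprD.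
  by apply/eqP; rewrite eq_complex /= !eqxx.
- move=> [r s] x.
  have kE (r' s' : R) y : (r' +i* s') *: y = r'%:C *: y + s'%:C *: ('i%C *: y).
    by rewrite scalerA -scalerDl; congr (_ *: _); simpc.
  rewrite /w kE scalerDr !scalerA !fD; apply/eqP; rewrite eq_complex /=.
  rewrite ['i%C * r%:C]mulrC -!scalerA !fZ.
  have -> : 'i%C *: (s%:C *: ('i%C *: x)) = (- s)%:C *: x.
    by rewrite !scalerA; congr (_ *: _); simpc.
  by rewrite fZ; apply/andP; split; apply/eqP; ring.
- move=> x; rewrite /w fS.
  have -> : 'i%C *: star x = star (- ('i%C *: x)).
    by rewrite -scaleNr starZ; congr (_ *: _); simpc.
  by rewrite fS fN.
- move=> x; rewrite wS// lecR; apply: gpos; exact: positive_mulstar.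
- move=> x; apply: le_trans (normc_le _) _; rewrite /w /= normrN.
  have := fle x; have := fle ('i%C *: x).
  rewrite nrmZ (_ : normc 'i%C = 1) ?mul1r; first by lra.
  by rewrite /= expr0n expr1n add0r sqrtr1.
Qed.

End State.

(** * Closed *-subalgebras *)

Section Subalgebra.
Variables (R : realType) (B : cstarType R).

Record star_subalgebra := StarSubalgebra {
  ssub_set :> set B;
  ssub0 : ssub_set 0;
  ssubD : forall x y, ssub_set x -> ssub_set y -> ssub_set (x + y);
  ssubZ : forall (k : R[i]) x, ssub_set x -> ssub_set (k *: x);
  ssubM : forall x y, ssub_set x -> ssub_set y -> ssub_set (x ** y);
  ssub_star : forall x, ssub_set x -> ssub_set (star x);
  ssub_closed : closed ssub_set }.

Variable S : star_subalgebra.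

Record subalg : Type := Subalg { subalg_val :> B; subalg_in : ssub_set S subalg_val }.

Lemma subalg_val_inj (x y : subalg) : subalg_val x = subalg_val y -> x = y.
Proof.
case: x y => [x Sx] [y Sy] /= xy; subst y.
by rewrite (Prop_irrelevance Sx Sy).
Qed.

HB.instance Definition _ := gen_eqMixin subalg.
HB.instance Definition _ := gen_choiceMixin subalg.

Let ssubN x : ssub_set S x -> ssub_set S (- x).
Proof. by rewrite -scaleN1r; exact: ssubZ. Qed.

Let szero : subalg := Subalg (ssub0 S).
Let sadd (x y : subalg) : subalg := Subalg (ssubD (subalg_in x) (subalg_in y)).
Let sopp (x : subalg) : subalg := Subalg (ssubN (subalg_in x)).
Let sscale (k : R[i]) (x : subalg) : subalg := Subalg (ssubZ k (subalg_in x)).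
Let smul (x y : subalg) : subalg := Subalg (ssubM (subalg_in x) (subalg_in y)).
Let sstar (x : subalg) : subalg := Subalg (ssub_star (subalg_in x)).

Let saddA : associative sadd.
Proof. by move=> x y z; apply: subalg_val_inj; exact: addrA. Qed.
Let saddC : commutative sadd.
Proof. by move=> x y; apply: subalg_val_inj; exact: addrC. Qed.
Let sadd0 : left_id szero sadd.
Proof. by move=> x; apply: subalg_val_inj; exact: add0r. Qed.
Let saddN : left_inverse szero sopp sadd.
Proof. by move=> x; apply: subalg_val_inj; exact: addNr. Qed.

HB.instance Definition _ := GRing.isZmodule.Build subalg saddA saddC sadd0 saddN.

Let sscaleA k l (x : subalg) : sscale k (sscale l x) = sscale (k * l) x.
Proof. by apply: subalg_val_inj; exact: scalerA. Qed.
Let sscale1 : left_id 1 sscale.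
Proof. by move=> x; apply: subalg_val_inj; exact: scale1r. Qed.
Let sscaleDr : right_distributive sscale +%R.
Proof. by move=> k x y; apply: subalg_val_inj; exact: scalerDr. Qed.
Let sscaleDl (x : subalg) : {morph sscale^~ x : k l / k + l}.
Proof. by move=> k l; apply: subalg_val_inj; exact: scalerDl. Qed.

HB.instance Definition _ := GRing.Zmodule_isLmodule.Build R[i] subalg
  sscaleA sscale1 sscaleDr sscaleDl.

Let smulA : associative smul.
Proof. by move=> x y z; apply: subalg_val_inj; exact: starmulA. Qed.
Let smulDl : left_distributive smul +%R.
Proof. by move=> x y z; apply: subalg_val_inj; exact: starmulDl. Qed.
Let smulDr : right_distributive smul +%R.
Proof. by move=> x y z; apply: subalg_val_inj; exact: starmulDr. Qed.
Let smulZl (k : R[i]) (x y : subalg) : smul (k *: x) y = k *: smul x y.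
Proof. by apply: subalg_val_inj; exact: starmulZl. Qed.
Let smulZr (k : R[i]) (x y : subalg) : smul x (k *: y) = k *: smul x y.
Proof. by apply: subalg_val_inj; exact: starmulZr. Qed.
Let sstarK : involutive sstar.
Proof. by move=> x; apply: subalg_val_inj; exact: starK. Qed.
Let sstarD : {morph sstar : x y / x + y}.
Proof. by move=> x y; apply: subalg_val_inj; exact: starD. Qed.
Let sstarZ (k : R[i]) (x : subalg) : sstar (k *: x) = (k^*)%C *: sstar x.
Proof. by apply: subalg_val_inj; exact: starZ. Qed.
Let sstarM (x y : subalg) : sstar (smul x y) = smul (sstar y) (sstar x).
Proof. by apply: subalg_val_inj; exact: starM. Qed.

HB.instance Definition _ := isStarAlg.Build R subalg
  smulA smulDl smulDr smulZl smulZr sstarK sstarD sstarZ sstarM.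

Let norm (x : subalg) : R[i] := `|subalg_val x|.

Let normD (x y : subalg) : norm (x + y) <= norm x + norm y.
Proof. exact: ler_normD. Qed.
Let normZ (k : R[i]) (x : subalg) : norm (k *: x) = `|k| * norm x.
Proof. exact: normrZ. Qed.
Let norm0 (x : subalg) : norm x = 0 -> x = 0.
Proof. by move=> /normr0_eq0 x0; exact: subalg_val_inj. Qed.

HB.instance Definition _ := Lmodule_isNormed.Build R[i] subalg normD normZ norm0.

Let scomplete (F : set_system subalg) : ProperFilter F -> cauchy F -> cvg F.
Proof.
move=> FF Fc.
have [l Fl] : exists l : B, subalg_val @ F --> l.
  apply: (cvg_lipschitzV FF Fc (c := 1)) => x y; rewrite mul1r; exact: lexx.
have Sl : ssub_set S l.
  rewrite ((closure_id _).1 (@ssub_closed S)) => V lV.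
  have [x Vx] := @filter_ex _ F _ (@subalg_val @^-1` V) (Fl V lV).
  by exists (subalg_val x); split=> //; exact: (subalg_in x).
apply/cvg_ex; exists (Subalg Sl); apply/cvg_nrm => e e0.
by move/cvg_nrm: Fl => /(_ _ e0).
Qed.

HB.instance Definition _ := Uniform_isComplete.Build subalg scomplete.

Let snormM (x y : subalg) : `|x ** y| <= `|x| * `|y|.
Proof. exact: cstar_normM. Qed.
Let scstar (x : subalg) : `|star x ** x| = `|x| ^+ 2.
Proof. exact: (cstar_norm (subalg_val x)). Qed.

HB.instance Definition _ := isCStarAlg.Build R subalg snormM scstar.

End Subalgebra.

(** * Matrices of growing size converging *-strongly *)

Lemma closed_nrm (R : realType) (V : normedModType R[i]) (E : set V) :
  closed E <->
  forall x, (forall e : R, 0 < e -> exists2 y, E y & nrm (x - y) < e) -> E x.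
Proof.
split=> [cE x H|H x clx].
  rewrite ((closure_id _).1 cE) => U /nbhs_ballP[e /= e0 xeU].
  have [r r0 eE] := complex_gt0P e0; have [y Ey xy] := H r r0.
  by exists y; split=> //; apply: xeU; rewrite -ball_normE /= nrmE eE ltcR.
apply: H => e e0; have [y [Ey xy]] : E `&` ball x e%:C !=set0.
  by apply: clx; apply: nbhsx_ballx; rewrite ltcR.
by exists y => //; move: xy; rewrite -ball_normE /= nrmE ltcR.
Qed.

Section StrongConvergence.
Variable R : realType.
Implicit Types (v w : nat -> R[i]) (f g : forall n, 'cV[R[i]]_n).

(** Vectors of different sizes are compared through [nat -> R[i]], the vectors
    of finite support playing the role of a dense subspace of l^2; [trunc]
    sends such a vector to its first [n] coordinates. *)
Definition finsupp v := exists m : nat, forall i, (m <= i)%N -> v i = 0.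

Definition trunc v n : 'cV[R[i]]_n := \col_(i < n) v i.

Lemma finsuppD v w : finsupp v -> finsupp w -> finsupp (fun i => v i + w i).
Proof.
move=> [m vm] [k wk]; exists (maxn m k) => i.
by rewrite geq_max => /andP[/vm -> /wk ->]; rewrite addr0.
Qed.

Lemma finsuppZ (k : R[i]) v : finsupp v -> finsupp (fun i => k * v i).
Proof. by move=> [m vm]; exists m => i /vm ->; rewrite mulr0. Qed.

Lemma truncD v w n : trunc (fun i => v i + w i) n = trunc v n + trunc w n.
Proof. by apply/colP => i; rewrite !mxE. Qed.

Lemma truncZ (k : R[i]) v n : trunc (fun i => k * v i) n = k *: trunc v n.
Proof. by apply/colP => i; rewrite !mxE. Qed.

Lemma trunc_bounded v : finsupp v -> exists K : R, forall n, vnorm (trunc v n) <= K.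
Proof.
move=> [m vm]; exists (\sum_(0 <= i < m) normc (v i)) => n.
apply: le_trans (vnorm_le_sum _) _.
under eq_bigr do rewrite mxE.
rewrite -(big_mkord xpredT (fun i => normc (v i))).
have [nm|/ltnW mn] := leqP n m.
  rewrite [leRHS](big_cat_nat (n := n))//= lerDl.
  by rewrite sumr_ge0// => i _; exact: normc_ge0.
rewrite (big_cat_nat (n := m))//= [X in _ + X]big1_seq ?addr0// => i /=.
by rewrite mem_index_iota => /andP[mi _]; rewrite vm// normc0.
Qed.

(** Norm convergence in l^2 of a sequence of vectors of growing size, as the
    Cauchy condition: up to any [e] the sequence is eventually a fixed vector of
    finite support. No limit has to be named. *)
Definition sconv f := forall e : R, 0 < e -> exists w, finsupp w /\
  \forall n \near \oo, vnorm (f n - trunc w n) <= e.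

Definition snull f := forall e : R, 0 < e -> \forall n \near \oo, vnorm (f n) <= e.

Lemma snull_sconv f : snull f -> sconv f.
Proof.
move=> f0 e e0; exists (fun=> 0); split; first by exists 0%N.
apply: filterS (f0 e e0) => n; rewrite (_ : trunc _ n = 0) ?subr0//.
by apply/colP => i; rewrite !mxE.
Qed.

Lemma snullD f g : snull f -> snull g -> snull (fun n => f n + g n).
Proof.
move=> f0 g0 e e0; have e2 : 0 < e / 2 by rewrite divr_gt0.
apply: filterS2 (f0 _ e2) (g0 _ e2) => n fn gn.
by apply: le_trans (vnormD _ _) _; rewrite [e]splitr lerD.
Qed.

Lemma sconvD f g : sconv f -> sconv g -> sconv (fun n => f n + g n).
Proof.
move=> fc gc e e0; have e2 : 0 < e / 2 by rewrite divr_gt0.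
have [v [fv hv]] := fc _ e2; have [w [fw hw]] := gc _ e2.
exists (fun i => v i + w i); split; first exact: finsuppD.
apply: filterS2 hv hw => n fn gn; rewrite truncD opprD addrACA.
by apply: le_trans (vnormD _ _) _; rewrite [e]splitr lerD.
Qed.

Section Operators.
Variables (T : forall n, 'M[R[i]]_n) (K : R).
Hypothesis TK : forall n (u : 'cV_n), vnorm (T n *m u) <= K * vnorm u.

Let K1_gt0 : 0 < `|K| + 1.
Proof. by rewrite ltr_wpDl. Qed.

Let TK1 n (u : 'cV_n) : vnorm (T n *m u) <= (`|K| + 1) * vnorm u.
Proof.
apply: le_trans (TK u) _; rewrite ler_wpM2r ?vnorm_ge0//.
by apply: le_trans (ler_norm K) _; rewrite lerDl.
Qed.

Lemma snull_mul f : snull f -> snull (fun n => T n *m f n).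
Proof.
move=> f0 e e0; apply: filterS (f0 _ (divr_gt0 e0 K1_gt0)) => n.
by rewrite ler_pdivlMr// mulrC; apply: le_trans.
Qed.

(** A bounded sequence of operators that converges on finitely supported vectors
    converges on all convergent sequences of vectors, which are uniformly close
    to such vectors. *)
Lemma sconv_mul f : (forall v, finsupp v -> sconv (fun n => T n *m trunc v n)) ->
  sconv f -> sconv (fun n => T n *m f n).
Proof.
move=> Tc fc e e0; have e2 : 0 < e / 2 by rewrite divr_gt0.
have [v [fv hv]] := fc _ (divr_gt0 e2 K1_gt0); have [w [fw hw]] := Tc v fv _ e2.
exists w; split=> //; apply: filterS2 hv hw => n.
rewrite ler_pdivlMr// mulrC => h1 h2.
have -> : T n *m f n - trunc w n = T n *m (f n - trunc v n) + (T n *m trunc v n - trunc w n).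
  by rewrite mulmxBr addrA subrK.
apply: le_trans (vnormD _ _) _; rewrite [e]splitr lerD//.
exact: le_trans (TK1 _) h1.
Qed.

Lemma snull_mul_sconv f : (forall v, finsupp v -> snull (fun n => T n *m trunc v n)) ->
  sconv f -> snull (fun n => T n *m f n).
Proof.
move=> Tc fc e e0; have e2 : 0 < e / 2 by rewrite divr_gt0.
have [v [fv hv]] := fc _ (divr_gt0 e2 K1_gt0).
apply: filterS2 hv (Tc v fv _ e2) => n; rewrite ler_pdivlMr// mulrC => h1 h2.
have -> : T n *m f n = T n *m (f n - trunc v n) + T n *m trunc v n.
  by rewrite mulmxBr subrK.
apply: le_trans (vnormD _ _) _; rewrite [e]splitr lerD//.
exact: le_trans (TK1 _) h1.
Qed.

End Operators.

Lemma snullZ (k : R[i]) f : snull f -> snull (fun n => k *: f n).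
Proof.
move=> f0 e e0; have k1 : 0 < normc k + 1 by rewrite ltr_wpDl ?normc_ge0.
apply: filterS (f0 _ (divr_gt0 e0 k1)) => n; rewrite ler_pdivlMr// vnormZ.
apply: le_trans; rewrite mulrC ler_wpM2l ?vnorm_ge0// lerDl.
by [].
Qed.

Lemma sconvZ (k : R[i]) f : sconv f -> sconv (fun n => k *: f n).
Proof.
move=> fc e e0; have k1 : 0 < normc k + 1 by rewrite ltr_wpDl ?normc_ge0.
have [w [fw hw]] := fc _ (divr_gt0 e0 k1).
exists (fun i => k * w i); split; first exact: finsuppZ.
apply: filterS hw => n; rewrite ler_pdivlMr// truncZ -scalerBr vnormZ.
apply: le_trans; rewrite mulrC ler_wpM2l ?vnorm_ge0// lerDl.
by [].
Qed.

Lemma snull_approx f : (forall e : R, 0 < e -> exists2 g, snull g &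
  forall n, vnorm (f n - g n) <= e) -> snull f.
Proof.
move=> fg e e0; have e2 : 0 < e / 2 by rewrite divr_gt0.
have [g g0 h] := fg _ e2; apply: filterS (g0 _ e2) => n gn.
rewrite -(subrK (g n) (f n)); apply: le_trans (vnormD _ _) _.
by rewrite [e]splitr lerD.
Qed.

Lemma sconv_approx f : (forall e : R, 0 < e -> exists2 g, sconv g &
  forall n, vnorm (f n - g n) <= e) -> sconv f.
Proof.
move=> fg e e0; have e2 : 0 < e / 2 by rewrite divr_gt0.
have [g gc h] := fg _ e2; have [w [fw hw]] := gc _ e2.
exists w; split=> //; apply: filterS hw => n gn.
rewrite -(subrK (g n) (f n)) -addrA; apply: le_trans (vnormD _ _) _.
by rewrite [e]splitr lerD.
Qed.

(* bounded sequences of matrices of growing size *)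
Notation mxprod := (bprod (fun n => mxalg R n)).
Implicit Types S T : mxprod.

Definition mxact T f n : 'cV[R[i]]_n := (T n : 'M_n) *m f n.

Lemma mxact_le T n (u : 'cV_n) : vnorm ((T n : 'M_n) *m u) <= supnorm T * vnorm u.
Proof.
apply: le_trans (opnorm_le _ _) _; rewrite ler_wpM2r ?vnorm_ge0//.
exact: (supnorm_ub T n).
Qed.

(** For [P = sconv] this is *-strong convergence, and for [P = snull] *-strong
    convergence to 0, tested on finitely supported vectors only; bounded
    sequences behave in the same way on l^2. *)
Definition strongly (P : (forall n, 'cV[R[i]]_n) -> Prop) T :=
  forall v, finsupp v -> P (mxact T (trunc v)) /\ P (mxact (star T) (trunc v)).

(** A uniform error [d] on the operators gives an error at most [d K] on the
    vectors [trunc v n], whose norms have a common bound [K]. *)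
Lemma strongly_closed P :
  (forall f, (forall e : R, 0 < e -> exists2 g, P g &
    forall n, vnorm (f n - g n) <= e) -> P f) -> closed (strongly P).
Proof.
move=> Pc; apply/closed_nrm => T HT v fv.
have [K vK] := trunc_bounded fv.
have K0 : 0 <= K := le_trans (vnorm_ge0 _) (vK 0%N).
have K1 : 0 < K + 1 by rewrite ltr_wpDl.
split; apply: Pc => e e0.
  have [S PS TS] := HT _ (divr_gt0 e0 K1).
  exists (mxact S (trunc v)) => [|n]; first exact: (PS v fv).1.
  rewrite /mxact -mulmxBl; apply: le_trans (mxact_le (T - S) _) _.
  move: TS; rewrite nrm_bprod ltr_pdivlMr// => /ltW; apply: le_trans.
  by rewrite ler_wpM2l ?supnorm_ge0// (le_trans (vK n))// lerDl.
have [S PS TS] := HT _ (divr_gt0 e0 K1).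
exists (mxact (star S) (trunc v)) => [|n]; first exact: (PS v fv).2.
rewrite /mxact -mulmxBl; apply: le_trans (mxact_le (star T - star S) _) _.
move: TS; rewrite -(nrm_star (T - S)) starB nrm_bprod ltr_pdivlMr// => /ltW.
apply: le_trans.
by rewrite ler_wpM2l ?supnorm_ge0// (le_trans (vK n))// lerDl.
Qed.

Lemma eq_family (P : (forall n, 'cV[R[i]]_n) -> Prop) f g :
  (forall n, f n = g n) -> P f -> P g.
Proof. by move=> fg; rewrite (_ : g = f)//; apply: functional_extensionality_dep. Qed.

Lemma strongly0 P : P (fun n => 0) -> strongly P 0.
Proof.
move=> P0 v _; rewrite star0.
by split; apply: (eq_family (f := fun n => 0) _ P0) => n; exact/esym/mul0mx.
Qed.

Lemma stronglyD P : (forall f g, P f -> P g -> P (fun n => f n + g n)) ->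
  forall S T, strongly P S -> strongly P T -> strongly P (S + T).
Proof.
move=> PD S T PS PT v fv; have [S1 S2] := PS v fv; have [T1 T2] := PT v fv; split.
  by apply: (eq_family _ (PD _ _ S1 T1)) => n; rewrite /mxact -mulmxDl.
by apply: (eq_family _ (PD _ _ S2 T2)) => n; rewrite starD /mxact -mulmxDl.
Qed.

Lemma stronglyZ P : (forall (k : R[i]) f, P f -> P (fun n => k *: f n)) ->
  forall (k : R[i]) T, strongly P T -> strongly P (k *: T).
Proof.
move=> PZ k T PT v fv; have [T1 T2] := PT v fv; split.
  by apply: (eq_family _ (PZ k _ T1)) => n; rewrite /mxact scalemxAl.
by apply: (eq_family _ (PZ (k^*)%C _ T2)) => n; rewrite starZ /mxact scalemxAl.
Qed.

Lemma strongly_star P T : strongly P T -> strongly P (star T).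
Proof. by move=> PT v fv; have [? ?] := PT v fv; split; rewrite ?starK. Qed.

Let snull0 : snull (fun n => 0).
Proof. by move=> e e0; apply: nearW => n; rewrite vnorm0 ltW. Qed.

Let strongM (P : (forall n, 'cV[R[i]]_n) -> Prop) S T v : (forall f, P f -> P (mxact S f)) ->
  P (mxact T (trunc v)) -> P (mxact (S ** T) (trunc v)).
Proof.
move=> PS PT; have E n : mxact S (mxact T (trunc v)) n = mxact (S ** T) (trunc v) n.
  exact: mulmxA.
exact: eq_family E (PS _ PT).
Qed.

(** Strong convergence is compatible with products because [S] is bounded; for
    the adjoints the roles of [S] and [T] are exchanged. *)
Let sconvM S T : strongly sconv S -> strongly sconv T -> strongly sconv (S ** T).
Proof.
move=> PS PT v fv; rewrite starM; split; apply: (strongM (P := sconv)).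
- by move=> f fc; apply: (sconv_mul (@mxact_le S) _ fc) => w fw; exact: (PS w fw).1.
- exact: (PT v fv).1.
- by move=> f fc; apply: (sconv_mul (@mxact_le (star T)) _ fc) => w fw; exact: (PT w fw).2.
- exact: (PS v fv).2.
Qed.

Definition strong_subalgebra : star_subalgebra mxprod :=
  StarSubalgebra (strongly0 (snull_sconv snull0)) (stronglyD sconvD)
    (stronglyZ sconvZ) sconvM (@strongly_star sconv) (strongly_closed sconv_approx).

(** Taking limits identifies [strong_seqs] modulo [snull_ideal] with the bounded
    operators on l^2. *)
Definition strong_seqs : cstarType R := subalg strong_subalgebra.

Let N : set strong_seqs := [set T | strongly snull (subalg_val T)].

Let N0 : N 0. Proof. exact: strongly0. Qed.
Let ND x y : N x -> N y -> N (x + y). Proof. exact: stronglyD snullD _ _. Qed.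
Let NZ (k : R[i]) x : N x -> N (k *: x). Proof. exact: stronglyZ snullZ _ _. Qed.

Let NMl (b x : strong_seqs) : N x -> N (b ** x).
Proof.
move=> Nx v fv; split.
  apply: (strongM (P := snull) (S := subalg_val b)); last exact: (Nx v fv).1.
  by move=> f fc; exact: (snull_mul (@mxact_le (subalg_val b)) fc).
rewrite [star _](starM (subalg_val b) (subalg_val x)).
apply: (eq_family _ (snull_mul_sconv (@mxact_le (star (subalg_val x)))
  (fun w fw => (Nx w fw).2) (subalg_in b v fv).2)) => n.
by rewrite /mxact mulmxA.
Qed.

Let NMr (b x : strong_seqs) : N x -> N (x ** b).
Proof.
move=> Nx v fv; split.
  apply: (eq_family _ (snull_mul_sconv (@mxact_le (subalg_val x))
    (fun w fw => (Nx w fw).1) (subalg_in b v fv).1)) => n.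
  by rewrite /mxact mulmxA.
rewrite [star _](starM (subalg_val x) (subalg_val b)).
apply: (strongM (P := snull) (S := star (subalg_val b))); last exact: (Nx v fv).2.
by move=> f fc; exact: (snull_mul (@mxact_le (star (subalg_val b))) fc).
Qed.

Let Nclosed : closed N.
Proof.
apply/closed_nrm => x Hx.
apply: (closed_nrm _).1 (strongly_closed snull_approx) (subalg_val x) _ => e e0.
by have [y Ny xy] := Hx e e0; exists (subalg_val y).
Qed.

Definition snull_ideal : cstar_ideal strong_seqs := CStarIdeal N0 ND NZ NMl NMr Nclosed.

Lemma snull_idealE (T : strong_seqs) :
  ideal_set snull_ideal T = strongly snull (subalg_val T).
Proof. by []. Qed.

End StrongConvergence.

(** * The form of a positive functional and its orthonormal families *)

Section GNS.
Variables (R : realType) (A : cstarType R) (w : A -> R[i]).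
Hypothesis sw : positive_functional w.
Implicit Types (x y z c d : A) (k : R[i]).

(** The GNS inner product, conjugate linear in [x]; it may be degenerate. *)
Definition ip x y : R[i] := w (star x ** y).

Definition sq x : R := complex.Re (ip x x).

Lemma ipDr x y z : ip x (y + z) = ip x y + ip x z.
Proof. by rewrite /ip starmulDr (posfunD sw). Qed.

Lemma ipZr k x y : ip x (k *: y) = k * ip x y.
Proof. by rewrite /ip starmulZr (posfunZ sw). Qed.

Lemma ipC x y : ip y x = ((ip x y)^*)%C.
Proof. by rewrite /ip -(posfun_star sw) starM starK. Qed.

Lemma ipDl x y z : ip (x + y) z = ip x z + ip y z.
Proof. by rewrite /ip starD starmulDl (posfunD sw). Qed.

Lemma ipZl k x y : ip (k *: x) y = (k^*)%C * ip x y.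
Proof. by rewrite /ip starZ starmulZl (posfunZ sw). Qed.

Lemma ip0r x : ip x 0 = 0.
Proof. by rewrite -(scale0r x) ipZr mul0r. Qed.

Lemma ip0l x : ip 0 x = 0.
Proof. by rewrite ipC ip0r conjc0. Qed.

Lemma ipNr x y : ip x (- y) = - ip x y.
Proof. by rewrite -scaleN1r ipZr mulN1r. Qed.

Lemma ipBr x y z : ip x (y - z) = ip x y - ip x z.
Proof. by rewrite ipDr ipNr. Qed.

Lemma ipBl x y z : ip (x - y) z = ip x z - ip y z.
Proof. by rewrite -scaleN1r ipDl ipZl rmorphN rmorph1 mulN1r. Qed.

Lemma ip_sumr (I : Type) (r : seq I) (F : I -> A) x :
  ip x (\sum_(i <- r) F i) = \sum_(i <- r) ip x (F i).
Proof. by rewrite (big_morph _ (ipDr x) (ip0r x)). Qed.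

Lemma ip_suml (I : Type) (r : seq I) (F : I -> A) x :
  ip (\sum_(i <- r) F i) x = \sum_(i <- r) ip (F i) x.
Proof. by rewrite (big_morph (ip^~ x) (fun y z => ipDl y z x) (ip0l x)). Qed.

Lemma ip_mul_star x y z : ip (x ** y) z = ip y (star x ** z).
Proof. by rewrite /ip starM starmulA. Qed.

Lemma ip_sq x : ip x x = (sq x)%:C.
Proof. by rewrite /sq RRe_real// ger0_real// (posfun_ge0 sw). Qed.

Lemma sq_ge0 x : 0 <= sq x.
Proof. by rewrite -lecR -ip_sq (posfun_ge0 sw). Qed.

Lemma sq_le x : sq x <= 2 * nrm x ^+ 2.
Proof.
have := posfun_le sw (star x ** x); rewrite nrm_cstar -/(ip x x) ip_sq normc_real.
by rewrite ger0_norm// sq_ge0.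
Qed.

Lemma sqD x y : sq (x + y) <= 2 * sq x + 2 * sq y.
Proof.
suff : sq (x + y) + sq (x - y) = 2 * sq x + 2 * sq y by have := sq_ge0 (x - y); lra.
apply: complexI; rewrite !rmorphD !rmorphM /= -!ip_sq.
have -> : (2 : R)%:C = 2 :> R[i] by exact: rmorph_nat (real_complex R) 2.
by rewrite !(ipBl, ipBr) !(ipDl, ipDr); ring.
Qed.

(** The left multiplication by [x] is bounded for the seminorm of the form,
    which is what makes it an operator on the GNS space. *)
Lemma sqM x y : sq (x ** y) <= nrm x ^+ 2 * sq y.
Proof.
have [b bE] := positive_nrm_sub x y.
have : nrm x ^+ 2 * sq y = sq (x ** y) + sq b.
  apply: complexI; rewrite rmorphM rmorphD /= -!ip_sq.
  by rewrite -(posfunZ sw) bE (posfunD sw).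
by have := sq_ge0 b; lra.
Qed.

Lemma sqZ (r : R) x : sq (r%:C *: x) = r ^+ 2 * sq x.
Proof.
apply: complexI; rewrite rmorphM /= -!ip_sq ipZl ipZr conjc_real mulrA -rmorphM.
by rewrite expr2.
Qed.

(** The form being degenerate, an orthonormal family is allowed to contain zero
    vectors; this keeps it indexed by [nat], whatever the dimension is. *)
Section Orthonormal.
Variable e : nat -> A.
Hypothesis e_orth : forall i j, i != j -> ip (e i) (e j) = 0.
Hypothesis e_unit : forall i, e i = 0 \/ ip (e i) (e i) = 1.

Definition comb n (u : 'cV[R[i]]_n) : A := \sum_(i < n) u i 0 *: e i.
Definition coords n c : 'cV[R[i]]_n := \col_(i < n) ip (e i) c.
Definition proj n c : A := comb (coords n c).

Lemma ip_comb_ge n (u : 'cV_n) (k : nat) : (n <= k)%N -> ip (e k) (comb u) = 0.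
Proof.
move=> nk; rewrite ip_sumr big1// => i _; rewrite ipZr e_orth ?mulr0//.
by apply: contraTneq (ltn_ord i) => <-; rewrite -leqNgt.
Qed.

Lemma ip_comb n (u : 'cV_n) (k : 'I_n) : ip (e k) (comb u) = u k 0 * ip (e k) (e k).
Proof.
rewrite ip_sumr (bigD1 k)//= big1 ?addr0 ?ipZr// => i ik.
by rewrite ipZr e_orth ?mulr0// eq_sym.
Qed.

Lemma ip_unit (k : nat) c : ip (e k) c * ip (e k) (e k) = ip (e k) c.
Proof. by case: (e_unit k) => ->; rewrite ?ip0l ?mul0r ?mulr1. Qed.

Lemma ip_proj n c (k : 'I_n) : ip (e k) (proj n c) = ip (e k) c.
Proof. by rewrite /proj ip_comb mxE ip_unit. Qed.

Lemma ip_combl n (u : 'cV_n) c : ip (comb u) c = dotv u (coords n c).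
Proof. by rewrite ip_suml /dotv; apply: eq_bigr => i _; rewrite ipZl mxE. Qed.

Lemma coords_proj n c : coords n (proj n c) = coords n c.
Proof. by apply/colP => k; rewrite !mxE ip_proj. Qed.

Lemma bessel n c : sq (c - proj n c) = sq c - vnorm (coords n c) ^+ 2.
Proof.
apply: complexI; rewrite rmorphB /= -!ip_sq -dotvv.
have H1 : ip (proj n c) c = dotv (coords n c) (coords n c) by exact: ip_combl.
have H2 : ip (proj n c) (proj n c) = dotv (coords n c) (coords n c).
  by rewrite ip_combl coords_proj.
have H3 : ip c (proj n c) = dotv (coords n c) (coords n c).
  by rewrite ipC H1 dotvv conjc_real.
by rewrite ipBr !ipBl H1 H2 H3; ring.
Qed.

Lemma coords_le n c : vnorm (coords n c) ^+ 2 <= sq c.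
Proof. by rewrite -subr_ge0 -bessel sq_ge0. Qed.

Lemma sq_comb n (u : 'cV_n) : sq (comb u) <= vnorm u ^+ 2.
Proof.
rewrite -lecR -ip_sq ip_combl -dotvv /dotv ler_sum// => i _.
rewrite mxE ip_comb; have : 0 <= (u i 0)^*%C * u i 0.
  by rewrite mulrC -sqr_normc exprn_ge0.
by case: (e_unit i) => -> h; rewrite ?ip0l ?mulr0 ?mulr1.
Qed.

Lemma coordsB n c d : coords n (c - d) = coords n c - coords n d.
Proof. by apply/colP => i; rewrite !mxE ipBr. Qed.

Lemma combB n (u v : 'cV_n) : comb (u - v) = comb u - comb v.
Proof.
by rewrite /comb -sumrB; apply: eq_bigr => i _; rewrite !mxE scalerBl.
Qed.

Lemma projB n c d : proj n (c - d) = proj n c - proj n d.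
Proof. by rewrite /proj coordsB combB. Qed.

(** By [bessel], since more coordinates are subtracted. *)
Lemma sq_proj_mono n m c : (n <= m)%N -> sq (c - proj m c) <= sq (c - proj n c).
Proof.
move=> nm; rewrite !bessel lerD2l lerN2 !vnorm_sqr.
under eq_bigr do rewrite mxE.
under [leRHS]eq_bigr do rewrite mxE.
rewrite -!(big_mkord xpredT (fun i => normc (ip (e i) c) ^+ 2)).
rewrite [leRHS](big_cat_nat (n := n))//= lerDl.
by rewrite sumr_ge0// => i _; exact: sqr_ge0.
Qed.

End Orthonormal.
End GNS.

(** * Gram-Schmidt process *)

Section GramSchmidt.
Variables (R : realType) (A : cstarType R) (w : A -> R[i]).
Hypothesis sw : positive_functional w.
Implicit Types (x y z c d : A).
Local Notation ip := (ip w).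
Local Notation sq := (sq w).

(** A null vector is sent to 0, because the inverse of 0 is 0. *)
Definition normalize x : A := ((Num.sqrt (sq x))^-1)%:C *: x.

Lemma ip_normalize x : normalize x = 0 \/ ip (normalize x) (normalize x) = 1.
Proof.
rewrite /normalize; have [x0|x0] := eqVneq (sq x) 0.
  by left; rewrite x0 sqrtr0 invr0 scale0r.
right; rewrite ip_sq// sqZ// exprVn sqr_sqrtr ?sq_ge0//.
by rewrite mulVf.
Qed.

Section Construction.
Variable a : nat -> A.

(** Carrying the list of all previous vectors makes the recursion structural. *)
Fixpoint gs n : seq A :=
  if n is m.+1 then
    rcons (gs m) (normalize (a m - \sum_(x <- gs m) ip x (a m) *: x))
  else [::].

Definition gram_schmidt n : A :=
  normalize (a n - \sum_(x <- gs n) ip x (a n) *: x).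

Arguments gram_schmidt : simpl never.
Local Notation e := gram_schmidt.

Let gsE n : gs n = mkseq e n.
Proof.
by elim: n => //= n IH; rewrite /mkseq -addn1 iotaD map_cat /= add0n cats1 -/(mkseq e n) -IH.
Qed.

Let res n := a n - proj w e n (a n).

Let eE n : e n = normalize (res n).
Proof.
rewrite /e gsE /res; congr (normalize (_ - _)).
rewrite big_map -(subn0 n) -/(index_iota 0 n) big_mkord.
by rewrite subn0; apply: eq_bigr => i _; rewrite mxE.
Qed.

Lemma gram_schmidt_unit i : e i = 0 \/ ip (e i) (e i) = 1.
Proof. exact: ip_normalize. Qed.

Let orth_lt n : forall i j, (i < n)%N -> (j < n)%N -> i != j -> ip (e i) (e j) = 0.
Proof.
elim: n => // n IH.
have H i : (i < n)%N -> ip (e i) (e n) = 0.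
  move=> ni; rewrite (eE n) /normalize ipZr// {2}/res ipBr//.
  rewrite {1}/proj /comb ip_sumr// (bigD1 (Ordinal ni))//= big1; last first.
    by move=> j ji; rewrite ipZr// (IH _ _ ni (ltn_ord j)) ?mulr0// eq_sym.
  rewrite addr0 ipZr// mxE /=.
  by case: (gram_schmidt_unit i) => ->; rewrite ?ip0l// ?mul0r ?mulr1 subrr mulr0.
move=> i j; rewrite !ltnS (leq_eqVlt i) (leq_eqVlt j) => /predU1P[->|ni] /predU1P[->|nj] ij.
- by rewrite eqxx in ij.
- by rewrite ipC// H// conjc0.
- exact: H.
- exact: IH.
Qed.

Lemma gram_schmidt_orth i j : i != j -> ip (e i) (e j) = 0.
Proof. by apply: (orth_lt (n := (maxn i j).+1)); rewrite ltnS ?leq_maxl ?leq_maxr. Qed.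

(** The component of [a n] orthogonal to the previous vectors is a multiple of
    [e n], or a null vector. *)
Lemma gram_schmidt_span n : sq (a n - proj w e n.+1 (a n)) = 0.
Proof.
have E : proj w e n.+1 (a n) = proj w e n (a n) + ip (e n) (a n) *: e n.
  rewrite /proj /comb big_ord_recr /= mxE; congr (_ + _).
  by apply: eq_bigr => i _; rewrite !mxE.
rewrite E opprD addrA -/(res n).
have en : ip (e n) (a n) = ip (e n) (res n).
  rewrite /res ipBr// (_ : ip (e n) (proj w e n (a n)) = 0) ?subr0//.
  exact: (ip_comb_ge sw gram_schmidt_orth).
rewrite en (eE n) /normalize ipZl// conjc_real ip_sq//.
have [r0|r0] := eqVneq (sq (res n)) 0.
  by rewrite r0 mulr0 scale0r subr0.
pose s := Num.sqrt (sq (res n)).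
have ss : s * s = sq (res n) by rewrite -expr2 sqr_sqrtr// sq_ge0.
have s0 : s != 0 by apply: contra_neq r0 => s0; rewrite -ss s0 mul0r.
rewrite -/s -rmorphM /= scaleCA -ss mulKf// divff// scaleC1 subrr.
by rewrite /sq ip0r.
Qed.

(** Approximate [c] by a term [a k]: the difference is small in the seminorm of
    the form by [sq_le], the projection does not increase it, and [a k] is its
    own projection up to a null vector as soon as [k < n]. *)
Lemma gram_schmidt_cvg c : (forall d : R, 0 < d -> exists k, nrm (c - a k) < d) ->
  forall d : R, 0 < d -> exists N, forall n, (N <= n)%N -> sq (c - proj w e n c) <= d.
Proof.
move=> dense_c d d0; have d4 : 0 <= d / 4 by rewrite divr_ge0// ltW.
have [|k ck] := dense_c (Num.sqrt (d / 4)); first by rewrite sqrtr_gt0 divr_gt0.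
have ck2 : nrm (c - a k) ^+ 2 <= d / 4.
  rewrite -(sqr_sqrtr d4) ler_pXn2r ?nnegrE ?nrm_ge0 ?sqrtr_ge0//.
  exact: ltW.
exists k.+1 => n kn.
have -> : c - proj w e n c = (c - a k - proj w e n (c - a k)) + (a k - proj w e n (a k)).
  by rewrite projB// opprB !addrA [RHS]+%R.[ACl 1*4*(2*5)*(3*6)] /= addNr subrr !addr0.
apply: le_trans (sqD sw _ _) _.
have := sq_proj_mono sw gram_schmidt_orth gram_schmidt_unit (a k) kn.
rewrite gram_schmidt_span.
have := bessel sw gram_schmidt_orth gram_schmidt_unit n (c - a k).
have := sqr_ge0 (vnorm (coords w e n (c - a k))); have := sq_le sw (c - a k).
by move: ck2; lra.
Qed.

End Construction.
End GramSchmidt.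

(** * Compressions to finite dimensional subspaces *)

Section Near.
Variable R : realType.
Implicit Types f g : forall n, 'cV[R[i]]_n.

Lemma snull_near f g : (\forall n \near \oo, f n = g n) -> snull f -> snull g.
Proof. by move=> fg f0 e e0; apply: filterS2 fg (f0 e e0) => n <-. Qed.

Lemma sconv_near f g : (\forall n \near \oo, f n = g n) -> sconv f -> sconv g.
Proof.
move=> fg fc e e0; have [w [fw hw]] := fc e e0; exists w; split=> //.
by apply: filterS2 fg hw => n <-.
Qed.
End Near.

Section Representation.
Variables (R : realType) (A : cstarType R) (w : A -> R[i]).
Hypothesis sw : positive_functional w.
Variable e : nat -> A.
Local Notation ip := (ip w).
Local Notation sq := (sq w).
Hypothesis e_orth : forall i j, i != j -> ip (e i) (e j) = 0.
Hypothesis e_unit : forall i, e i = 0 \/ ip (e i) (e i) = 1.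
Hypothesis e_total : forall c (d : R), 0 < d ->
  exists N, forall n, (N <= n)%N -> sq (c - proj w e n c) <= d.
Implicit Types (a b c d x y z : A) (v : nat -> R[i]).

Definition compress n a : mxalg R n := (\matrix_(i, j) ip (e i) (a ** e j) : 'M_n).

Lemma compress_mul n a (u : 'cV_n) :
  (compress n a : 'M_n) *m u = coords w e n (a ** comb e u).
Proof.
apply/colP => i; rewrite !mxE /comb.
rewrite (big_morph _ (starmulDr a) (starmul0 a)) ip_sumr//.
by apply: eq_bigr => j _; rewrite mxE starmulZr ipZr// mulrC.
Qed.

(** Bessel's inequality for [a ** comb e u], then [sqM] and [sq_comb]. *)
Lemma compress_le n a (u : 'cV_n) :
  vnorm ((compress n a : 'M_n) *m u) <= nrm a * vnorm u.
Proof.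
rewrite -(@ler_pXn2r _ 2) ?nnegrE ?mulr_ge0 ?vnorm_ge0 ?nrm_ge0//.
rewrite compress_mul exprMn; apply: le_trans (coords_le sw e_orth e_unit _ _) _.
apply: le_trans (sqM sw _ _) _; rewrite ler_wpM2l ?sqr_ge0//.
exact: sq_comb.
Qed.

Lemma compress_linear n (k : R[i]) a b :
  compress n (k *: a + b) = k *: compress n a + compress n b.
Proof.
by apply/matrixP => i j; rewrite !mxE starmulDl starmulZl ipDr// ipZr.
Qed.

Lemma compress_star n a : compress n (star a) = star (compress n a).
Proof.
by apply/matrixP => i j; rewrite !mxE -(ipC sw) ip_mul_star.
Qed.

Let compress_bounded a : exists K : R, forall n, nrm (compress n a) <= K.
Proof.
exists (nrm a) => n; rewrite nrm_mxalg; apply: opnorm_lub => [|u].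
  exact: nrm_ge0.
exact: compress_le.
Qed.

Definition compressions a : bprod (fun n => mxalg R n) := BProd (compress_bounded a).

(** Once [n] exceeds the support of [v], truncation does not change the
    combination. *)
Lemma comb_trunc v : finsupp v -> exists c,
  \forall n \near \oo, comb e (trunc v n) = c.
Proof.
move=> [m vm]; exists (\sum_(0 <= i < m) v i *: e i); exists m => // n /= mn.
transitivity (\sum_(i < n) v i *: e i); first by apply: eq_bigr => i _; rewrite mxE.
rewrite -(big_mkord xpredT (fun i => v i *: e i)) (big_cat_nat (n := m))//=.
rewrite [X in _ + X]big1_seq ?addr0// => i /=.
by rewrite mem_index_iota => /andP[mi _]; rewrite vm// scale0r.
Qed.

(** The tail of the coordinates is that of [c - proj w e m c], whose seminorm is
    small for large [m]. *)
Lemma sconv_coords c : sconv (fun n => coords w e n c).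
Proof.
move=> d d0; have [m hm] := e_total c (exprn_gt0 2 d0).
exists (fun i => if (i < m)%N then ip (e i) c else 0); split.
  by exists m => i; rewrite leqNgt => /negbTE ->.
exists m => // n /= mn.
have -> : coords w e n c - trunc (fun i => if (i < m)%N then ip (e i) c else 0) n =
    coords w e n (c - proj w e m c).
  apply/colP => i; rewrite !mxE ipBr//; congr (_ - _).
  case: ltnP => im; first by rewrite (ip_proj sw e_orth e_unit c (Ordinal im)).
  by rewrite (ip_comb_ge sw e_orth).
rewrite -(@ler_pXn2r _ 2) ?nnegrE ?vnorm_ge0 ?(ltW d0)//.
exact: le_trans (coords_le sw e_orth e_unit _ _) (hm m (leqnn m)).
Qed.

Lemma compressions_star a : compressions (star a) = star (compressions a).
Proof. by apply: bprod_ext => n; exact: compress_star. Qed.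

Let compressions_sconv1 a v : finsupp v -> sconv (mxact (compressions a) (trunc v)).
Proof.
move=> /comb_trunc[c hc]; apply: sconv_near (sconv_coords (a ** c)).
by apply: filterS hc => n <-; rewrite /mxact compress_mul.
Qed.

Lemma compressions_sconv a : strongly (@sconv R) (compressions a).
Proof.
by move=> v fv; rewrite -compressions_star; split; exact: compressions_sconv1.
Qed.

(** On [trunc v n], representing [c] in [A], the difference gives the
    coordinates of [a ** (d - proj w e n d)] for [d = b ** c]: the intermediate
    projection is the only error. *)
Let compressions_mul1 a b v : finsupp v ->
  snull (mxact (compressions (a ** b) - compressions a ** compressions b) (trunc v)).
Proof.
move=> /comb_trunc[c hc]; pose d := b ** c.
suff : snull (fun n => coords w e n (a ** (d - proj w e n d))).
  apply: snull_near; apply: filterS hc => n hn.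
  rewrite /mxact [RHS]mulmxBl -[(_ ** _ : bprod _) n]/(_ *m _) -mulmxA !compress_mul hn.
  by rewrite starmulBr coordsB// starmulA.
move=> r r0; have q0 : 0 < nrm a ^+ 2 + 1 by rewrite ltr_wpDl ?sqr_ge0.
have [N hN] := e_total d (divr_gt0 (exprn_gt0 2 r0) q0).
exists N => // n /= /hN; rewrite ler_pdivlMr// => hn.
rewrite -(@ler_pXn2r _ 2) ?nnegrE ?vnorm_ge0 ?(ltW r0)//.
apply: le_trans (coords_le sw e_orth e_unit _ _) _.
apply: le_trans (sqM sw _ _) _; apply: le_trans hn.
by rewrite mulrC ler_wpM2l ?sq_ge0// lerDl.
Qed.

Lemma compressions_mul a b :
  strongly (@snull R) (compressions (a ** b) - compressions a ** compressions b).
Proof.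
move=> v fv; split; first exact: compressions_mul1.
by rewrite starB starM -!compressions_star starM; exact: compressions_mul1.
Qed.

Definition compressions_in a : strong_seqs R :=
  Subalg (S := strong_subalgebra R) (compressions_sconv a).

Definition compression_class a : cquot (snull_ideal R) :=
  cpi (snull_ideal R) (compressions_in a).

Lemma compression_starhom : is_starhom compression_class.
Proof.
have [L M S] := cpi_starhom (snull_ideal R).
split=> [k a b|a b|a]; rewrite /compression_class -?L -?M -?S.
- congr cpi; apply: subalg_val_inj; apply: bprod_ext => n.
  exact: compress_linear.
- by apply/cpiP; rewrite snull_idealE; exact: compressions_mul.
- by congr cpi; apply: subalg_val_inj; exact: compressions_star.
Qed.

(** The [(i, j)] entry of the compressions is the same for all [n > i, j], so it
    can only tend to 0 if it is 0. *)
Lemma compression_class_eq0 a : compression_class a = 0 -> forall i j, ip (e i) (a ** e j) = 0.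
Proof.
move=> a0 i j; have := (cpiP (snull_ideal R) (compressions_in a) 0).1 a0.
rewrite snull_idealE => Na; pose v k : R[i] := (k == j)%:R.
have fv : finsupp v by exists j.+1 => k jk; rewrite /v gtn_eqF.
have Nv := (Na v fv).1; apply: eq0_normc; apply/eqP.
rewrite eq_le normc_ge0 andbT; apply/ler_addgt0Pr => r r0; rewrite add0r.
have [N _ hN] := Nv r r0; pose n := maxn N (maxn i j).+1.
have iN : (i < n)%N by rewrite /n !leq_max !ltnS leq_maxl orbT.
have jN : (j < n)%N by rewrite /n !leq_max !ltnS leq_maxr orbT.
apply: le_trans (hN n (leq_maxl _ _)); apply: le_trans (vnorm_entry _ (Ordinal iN)).
have -> : mxact (subalg_val (compressions_in a - 0)) (trunc v) n =
    coords w e n (a ** comb e (trunc v n)).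
  by rewrite subr0 -compress_mul.
rewrite mxE /= (_ : comb e (trunc v n) = e j)// /comb (bigD1 (Ordinal jN))//=.
rewrite mxE /v /= eqxx scale1r big1 ?addr0// => k kj.
by rewrite mxE -[(k == j :> nat)]/(k == Ordinal jN) (negbTE kj) scale0r.
Qed.

(** If all entries vanish, [x ** c] is a null vector for every combination [c] of
    the family, hence for [c = y], which is a limit of combinations. *)
Lemma compression_class_neq0 x y : sq (x ** y) != 0 -> compression_class x <> 0.
Proof.
move=> xy0 /compression_class_eq0 x0; case/negP: xy0; apply/eqP.
have xcomb m (u : 'cV_m) : sq (x ** comb e u) = 0.
  apply/eqP; rewrite eq_le sq_ge0// andbT; apply/ler_addgt0Pr => r r0; rewrite add0r.
  have [N /(_ N (leqnn N))] := e_total (x ** comb e u) r0.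
  rewrite bessel// (_ : coords w e N _ = 0) ?vnorm0 ?expr0n ?subr0//.
  apply/colP => i; rewrite !mxE /comb.
  rewrite (big_morph _ (starmulDr x) (starmul0 x)) ip_sumr// big1// => j _.
  by rewrite starmulZr ipZr// x0 mulr0.
apply/eqP; rewrite eq_le sq_ge0// andbT; apply/ler_addgt0Pr => r r0; rewrite add0r.
have q0 : 0 < 2 * nrm x ^+ 2 + 1 by rewrite ltr_wpDl// mulr_ge0// sqr_ge0.
have [m /(_ m (leqnn m))] := e_total y (divr_gt0 r0 q0).
rewrite ler_pdivlMr// => hm.
have -> : x ** y = x ** (y - proj w e m y) + x ** proj w e m y.
  by rewrite starmulBr subrK.
apply: le_trans (sqD sw _ _) _; rewrite xcomb mulr0 addr0.
have := sqM sw x (y - proj w e m y); have := sq_ge0 sw (y - proj w e m y).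
by move: hm; nra.
Qed.

End Representation.

(** * Lifting to matrix algebras *)

Section Final.
Variable R : realType.
Implicit Types A B : cstarType R.

Lemma mxalg_finite_dim n : finite_dim (mxalg R n).
Proof.
pose D := {: 'I_n * 'I_n}%type.
exists #|D|, (fun k => delta_mx (enum_val k).1 (enum_val k).2 : mxalg R n) => x.
exists (fun k => (x : 'M_n) (enum_val k).1 (enum_val k).2).
rewrite {1}[x]matrix_sum_delta pair_big /= (reindex (enum_val (A := D)))//=.
exact/onW_bij/enum_val_bij.
Qed.

Lemma starhom0 A (C : starAlgType R) (f : A -> C) : is_starhom f -> f 0 = 0.
Proof.
by move=> [L _ _]; have := L (-1) 0 0; rewrite scaleN1r oppr0 addr0 scaleN1r addNr.
Qed.

Lemma separable_seq A : separable A -> exists a : nat -> A,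
  forall c (d : R), 0 < d -> exists k, nrm (c - a k) < d.
Proof.
move=> [S /pcard_surjP[a aS] dS]; exists a => c d d0.
have dc : 0 < d%:C by rewrite ltcR.
have [||x [/interior_subset cx Sx]] := dS (interior (ball c d%:C)).
- by exists c; exact: nbhsx_ballx.
- exact: open_interior.
have [k _ ak] := aS x Sx; exists k.
by move: cx; rewrite ak -ball_normE /= nrmE ltcR.
Qed.

(** The functional is chosen not to vanish at [star z ** z] for
    [z = x ** h] with [h = star x ** x], so that [h] is a vector on which [x]
    acts nontrivially. *)
Lemma projective_RFD A : separable A -> projective A -> RFD A.
Proof.
move=> sA pA x x0; have [a da] := separable_seq sA.
pose h := star x ** x; have hh : star h = h by rewrite /h starM starK.
have z0 : x ** h != 0.
  apply: contra_neq x0 => z0; apply: starmulxx_eq0; apply: starmulxx_eq0.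
  by rewrite -/h hh {1}/h -starmulA z0 starmul0.
have [w sw wz] := exists_positive_functional z0.
pose e := gram_schmidt w a.
have e_orth := gram_schmidt_orth sw a : forall i j, i != j -> ip w (e i) (e j) = 0.
have e_unit := gram_schmidt_unit sw a : forall i, e i = 0 \/ ip w (e i) (e i) = 1.
have e_total c := gram_schmidt_cvg sw (da c).
have [psi hpsi psiE] := pA _ _ _ (compression_starhom sw e_orth e_unit e_total).
have psix : psi x <> 0.
  move=> p0; have := psiE x; rewrite p0 (starhom0 (cpi_starhom _)) => /esym.
  apply: (compression_class_neq0 (y := h)).
  by move: wz; rewrite -/(ip w _ _) ip_sq//; apply: contra_neq => ->.
have [n pn] : exists n, subalg_val (psi x) n <> 0.
  apply: contrapT => /forallNP H; apply: psix; apply: subalg_val_inj.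
  by apply: bprod_ext => n; apply: contrapT; exact: H.
exists (mxalg R n), (fun y => subalg_val (psi y) n); split; last exact/eqP.
  exact: mxalg_finite_dim.
by split=> [k y z|y z|y]; rewrite ?(starhom_linear hpsi) ?(starhom_mul hpsi) ?(starhom_star hpsi).
Qed.

Section Tail.
Variable C : nat -> cstarType R.

Let T n : set (bprod C) := [set b | forall i, (n <= i)%N -> b i = 0].

Let T0 n : T n 0. Proof. by []. Qed.
Let TD n x y : T n x -> T n y -> T n (x + y).
Proof. by move=> Tx Ty i ni; change (x i + y i = 0); rewrite Tx// Ty// addr0. Qed.
Let TZ n (k : R[i]) x : T n x -> T n (k *: x).
Proof. by move=> Tx i ni; change (k *: x i = 0); rewrite Tx// scaler0. Qed.
Let TMl n b x : T n x -> T n (b ** x).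
Proof. by move=> Tx i ni; change (b i ** x i = 0); rewrite Tx// starmul0. Qed.
Let TMr n b x : T n x -> T n (x ** b).
Proof. by move=> Tx i ni; change (x i ** b i = 0); rewrite Tx// star0mul. Qed.
Let Tclosed n : closed (T n).
Proof.
apply/closed_nrm => x Tx i ni; apply: (nrm_small (C := 1)) => d d0; rewrite mul1r.
have [y Ty xy] := Tx d d0; apply: le_trans (ltW xy).
apply: le_trans (supnorm_ub (x - y) i).
by change (nrm (x i) <= nrm (x i - y i)); rewrite (Ty i ni) subr0.
Qed.

Definition initial_ideal n : cstar_ideal (bprod C) :=
  CStarIdeal (@T0 n) (@TD n) (@TZ n) (@TMl n) (@TMr n) (@Tclosed n).

Lemma initial_idealP n b :
  ideal_set (initial_ideal n) b <-> forall i, (n <= i)%N -> b i = 0.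
Proof. by []. Qed.

Lemma initial_ideal_mono n : initial_ideal n `<=` initial_ideal n.+1.
Proof. by move=> b Tb i ni; apply: Tb; exact: ltnW. Qed.

(** The truncation is given through its entries, to hide the proof of
    boundedness. *)
Let head n (x : bprod C) : exists y : bprod C,
  forall i, y i = if (i < n)%N then x i else 0.
Proof.
have [K xK] := bprod_bounded x.
have yb : exists K : R, forall i, nrm (if (i < n)%N then x i else 0 : C i) <= K.
  exists K => i; case: ifP => // _; rewrite nrm0.
  exact: le_trans (nrm_ge0 _) (xK i).
by exists (BProd yb).
Qed.

(** A sequence tending to 0 is uniformly close to its truncations. *)
Lemma c0sum_closure : ideal_set (c0sum C) = closure (\bigcup_n initial_ideal n).
Proof.
apply/seteqP; split=> [x /cvgrPdist_lt x0|].
  have cE := @closed_closure _ (\bigcup_n (initial_ideal n : set (bprod C))).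
  apply: ((closed_nrm _).1 cE x) => d d0.
  have d2 : 0 < d / 2 by rewrite divr_gt0.
  have [N _ hN] := x0 _ d2; have [y yE] := head N x.
  exists y; first by apply: subset_closure; exists N => // i; rewrite yE ltnNge => ->.
  apply: le_lt_trans (_ : _ <= d / 2) _; last by rewrite ltr_pdivrMr// ltr_pMr// ltr1n.
  apply: supnorm_lub => i; change (nrm (x i - y i) <= d / 2); rewrite yE.
  case: ltnP => iN; first by rewrite subrr nrm0 ltW.
  have := hN i iN; rewrite /= sub0r normrN ger0_norm ?nrm_ge0// subr0.
  exact: ltW.
rewrite [X in _ `<=` X]((closure_id _).1 (@ideal_closed _ _ (c0sum C))).
apply: closure_subset => x [n _ nx]; apply/cvgrPdist_lt => d d0.
by exists n => // i /= ni; rewrite nx// nrm0 subrr normr0.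
Qed.

(** Two representatives of a class differ by a sequence that is 0 at [i]. *)
Lemma tail_starhom A n (f : A -> cquot (initial_ideal n)) i : (n <= i)%N ->
  is_starhom f -> is_starhom (fun a => repr (f a) i : C i).
Proof.
move=> ni hf; have [L M S] := cpi_starhom (initial_ideal n).
have E x y : cpi (initial_ideal n) x = cpi (initial_ideal n) y -> x i = y i.
  move=> /cpiP /(_ i ni) xy; apply/eqP; rewrite -subr_eq0; apply/eqP; exact: xy.
have K X : cpi (initial_ideal n) (repr X) = X by rewrite /cpi reprK.
split=> [k x y|x y|x].
- by apply: (E _ (k *: repr (f x) + repr (f y))); rewrite L !K (starhom_linear hf).
- by apply: (E _ (repr (f x) ** repr (f y))); rewrite M !K (starhom_mul hf).
- by apply: (E _ (star (repr (f x)))); rewrite S !K (starhom_star hf).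
Qed.

End Tail.

(** If all entries of the lift of [x] from some index on vanished, its image
    [phi x] modulo the sequences tending to 0 would be 0. *)
Lemma MF_semiprojective_RFD A : MF A -> semiprojective A -> RFD A.
Proof.
move=> [m [_ [D [phi [_ hphi iphi _]]]]] spA x x0.
have [n [psi hpsi psiE]] := spA _ _ _ (@initial_ideal_mono _) (c0sum_closure _) _ hphi.
have px0 : phi x <> 0.
  by rewrite -(starhom0 hphi) => /iphi x0'; rewrite x0' eqxx in x0.
have [i ni pi] : exists2 i, (n <= i)%N & repr (psi x) i <> 0.
  apply: contrapT => H; apply: px0; rewrite -psiE.
  rewrite /cquot_map -[RHS](starhom0 (cpi_starhom _)); apply/cpiP.
  rewrite subr0 c0sum_closure; apply: subset_closure; exists n => //.
  apply/initial_idealP => i ni.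
  by apply: contrapT => h; apply: H; exists i.
exists (mxalg R (m i)), (fun a => repr (psi a) i); split; last exact/eqP.
  exact: mxalg_finite_dim.
exact: (tail_starhom (C := fun j => mxalg R (m j)) ni hpsi).
Qed.

End Final.

Theorem proposition13p4 (R : realType) (A : cstarType R) (hA : separable A) :
  (projective A -> RFD A) /\ (MF A /\ semiprojective A -> RFD A).
Proof.
by split=> [|[]]; [exact: projective_RFD|exact: MF_semiprojective_RFD].
Qed.
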